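(* Fix an integer $m\ge2$ and let $Z$ be a fat point scheme in $\mathbb{P}^1\times\mathbb{P}^1$ all of whose points have multiplicity $m$. Then $Z$ is ACM if and only if $\mathrm{Supp}(Z)$ is a complete intersection.
   Context: $\mathbf{k}$ algebraically closed, $R=\mathbf{k}[x_0,x_1,y_0,y_1]$ bigraded with $\deg x_i=(1,0)$, $\deg y_i=(0,1)$; a point $[a_0:a_1]\times[b_0:b_1]$ has ideal $(a_1x_0-a_0x_1,b_1y_0-b_0y_1)$; a fat point scheme $Z=\{(P_1;m_1),\dots,(P_s;m_s)\}$ has ideal $I_Z=\bigcap\wp_{P_i}^{m_i}$ and is ACM if $R/I_Z$ is Cohen–Macaulay. A reduced set of points $\mathbb{X}$ is a complete intersection if its ideal is $I_{\mathbb{X}}=(F,G)$ with $F$ bihomogeneous of degree $(a,0)$ and $G$ bihomogeneous of degree $(0,b)$ for some $a,b$ (equivalently, $\mathbb{X}=\{R\times Q : R\in\pi_1(\mathbb{X}),\ Q\in\pi_2(\mathbb{X})\}$). *)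

(* Defs.v *)
From HB Require Import structures.
From mathcomp Require Import all_boot all_order all_algebra.
From mathcomp Require Import mpoly.
Set Implicit Arguments. Unset Strict Implicit. Unset Printing Implicit Defensive.
Import GRing.Theory.
Local Open Scope ring_scope.

(* The bigraded ring R = k[x0,x1,y0,y1] is {mpoly k[4]}:
   x0 = 'X_0, x1 = 'X_1, y0 = 'X_2, y1 = 'X_3. *)
Section Defs.
Variable k : closedFieldType.
Notation R := {mpoly k[4]}.

Definition i0 : 'I_4 := @Ordinal 4 0 isT.
Definition i1 : 'I_4 := @Ordinal 4 1 isT.
Definition i2 : 'I_4 := @Ordinal 4 2 isT.
Definition i3 : 'I_4 := @Ordinal 4 3 isT.
Definition x0 : R := 'X_i0.
Definition x1 : R := 'X_i1.
Definition y0 : R := 'X_i2.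
Definition y1 : R := 'X_i3.

Definition ideal_of := R -> Prop.

Definition gen_ideal (gs : seq R) : ideal_of :=
  fun f => exists c : 'I_(size gs) -> R, f = \sum_(i < size gs) c i * gs`_i.

Definition ideal_mul (I J : ideal_of) : ideal_of :=
  fun f => exists n (a b : 'I_n -> R),
    (forall i, I (a i)) /\ (forall i, J (b i)) /\ f = \sum_(i < n) a i * b i.

Fixpoint ideal_pow (I : ideal_of) (n : nat) : ideal_of :=
  match n with
  | 0 => fun _ => True
  | n'.+1 => ideal_mul (ideal_pow I n') I
  end.

Definition ideal_add_gen (I : ideal_of) (fs : seq R) : ideal_of :=
  fun h => exists g c, I g /\ h = g + c /\ gen_ideal fs c.

Definition is_ideal (P : ideal_of) : Prop :=
  P 0 /\ (forall f g, P f -> P g -> P (f + g)) /\ (forall r f, P f -> P (r * f)).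

Definition is_prime_ideal (P : ideal_of) : Prop :=
  is_ideal P /\ ~ P 1 /\ (forall f g, P (f * g) -> P f \/ P g).

Definition krull_dim_ge (I : ideal_of) (n : nat) : Prop :=
  exists P : nat -> ideal_of,
    (forall i, (i <= n)%N -> is_prime_ideal (P i)) /\
    (forall f, I f -> P 0%N f) /\
    (forall i, (i < n)%N ->
       (forall f, P i f -> P i.+1 f) /\ exists f, P i.+1 f /\ ~ P i f).

Definition irrelevant_ideal : ideal_of := gen_ideal [:: x0; x1; y0; y1].

Definition nzd_mod (J : ideal_of) (f : R) : Prop :=
  forall g, J (f * g) -> J g.

Definition regular_seq (I : ideal_of) (fs : seq R) : Prop :=
  (forall f, f \in fs -> irrelevant_ideal f) /\
  (forall i, (i < size fs)%N -> nzd_mod (ideal_add_gen I (take i fs)) fs`_i) /\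
  ~ ideal_add_gen I fs 1.

Definition depth_ge (I : ideal_of) (n : nat) : Prop :=
  exists fs : seq R, size fs = n /\ regular_seq I fs.

(* R/I is Cohen-Macaulay (graded sense): depth_m(R/I) = dim(R/I). *)
Definition cohen_macaulay_quot (I : ideal_of) : Prop :=
  forall n, krull_dim_ge I n <-> depth_ge I n.

(* points of P^1 x P^1: [a0:a1] x [b0:b1], coordinates (a0,a1,b0,b1) *)
Definition pt := (k * k * k * k)%type.
Definition pt_valid (P : pt) : Prop :=
  let: (a0, a1, b0, b1) := P in (a0 != 0 \/ a1 != 0) /\ (b0 != 0 \/ b1 != 0).
Definition pt_proj_eq (P Q : pt) : Prop :=
  let: (a0, a1, b0, b1) := P in let: (c0, c1, d0, d1) := Q in
  a0 * c1 = a1 * c0 /\ b0 * d1 = b1 * d0.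

Definition pt_ideal (P : pt) : ideal_of :=
  let: (a0, a1, b0, b1) := P in
  gen_ideal [:: a1 *: x0 - a0 *: x1; b1 *: y0 - b0 *: y1].

Definition fat_scheme_ideal (Z : seq (pt * nat)) : ideal_of :=
  fun f => forall p, p \in Z -> ideal_pow (pt_ideal p.1) p.2 f.

Definition fat_point_scheme (Z : seq (pt * nat)) : Prop :=
  Z <> [::] /\ (forall p, p \in Z -> pt_valid p.1) /\
  (forall p q, p \in Z -> q \in Z -> pt_proj_eq p.1 q.1 -> p = q).

Definition ACM (Z : seq (pt * nat)) : Prop :=
  cohen_macaulay_quot (fat_scheme_ideal Z).

Definition supp_ideal (Z : seq (pt * nat)) : ideal_of :=
  fun f => forall p, p \in Z -> pt_ideal p.1 f.

Definition bihomogeneous (F : R) (a b : nat) : Prop :=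
  forall mo, mo \in msupp F -> (mo i0 + mo i1 = a)%N /\ (mo i2 + mo i3 = b)%N.

Definition complete_intersection (IX : ideal_of) : Prop :=
  exists (a b : nat) (F G : R), bihomogeneous F a 0 /\ bihomogeneous G 0 b /\
    forall f, IX f <-> gen_ideal [:: F; G] f.

End Defs.

(* Main.v *)
From HB Require Import structures.
From Stdlib Require Import Classical.
Require Import Defs.
From mathcomp Require Import all_boot all_order all_algebra.
From mathcomp Require Import mpoly.
From mathcomp Require Import ring zify.
Set Implicit Arguments. Unset Strict Implicit. Unset Printing Implicit Defensive.
Import GRing.Theory.
Local Open Scope ring_scope.

(** Choose linear forms L in the x's and M in the y's that vanish at no point of Z,
    so that the support becomes a finite set S of pairs (a, b) in k x k and
    I_Z is the intersection of the ideals (x0 - a L, y0 - b M)^m.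

    The support is a complete intersection iff S is a grid A x B. For a grid,
    I_Z = (F, G)^m with F, G the products of the x0 - a L and of the y0 - b M,
    and L, M is a regular sequence modulo I_Z; comparing an arbitrary regular
    sequence with L, M shows that the depth is exactly 2.

    Conversely, if R/I_Z has depth 2 then L, M is a regular sequence modulo I_Z.
    Let D be the product of the y0 - b M over the full columns b, those with
    A x {b} in S. Each row of a non-grid S imposes m or m - 1 conditions; let d + 1
    be their sum over all rows. Because M is a nonzerodivisor modulo I_Z + (L), the
    factors of non-full columns can be cancelled from explicit elements of I_Z, so
    x0^d D is congruent modulo L to an element of I_Z of bidegree (d, deg D). Its
    Taylor coefficients along a row a are divisible by too many y0 - b M for their
    degree, so it is divisible by (x0 - a L)^m or (x0 - a L)^(m-1) according to the
    row; altogether d + 1 factors for a form of x-degree d, a contradiction. This is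
    where m >= 2 is used. *)

(** * Ideals, nonzerodivisors and powers of two-generated ideals *)

Section IdealCalculus.
Variable A : comNzRingType.
Implicit Types (J K : A -> Prop) (a b f g h u x : A).

Definition ideal J :=
  J 0 /\ (forall f g, J f -> J g -> J (f + g)) /\ (forall r f, J f -> J (r * f)).

Definition nzd J f := forall g, J (f * g) -> J g.

(** The ideal J + (a); the explicit cofactor turns membership in iterated extensions into syzygy
    equations. *)
Definition adj J a f := exists c, J (f - c * a).

Lemma ideal1 J r a f : ideal J -> J a -> f = r * a -> J f.
Proof. by case=> _ [_ JM] Ja ->; apply: JM. Qed.

Lemma ideal2 J r a s b f :
  ideal J -> J a -> J b -> f = r * a + s * b -> J f.
Proof. by move=> [_ [JD JM]] Ja Jb ->; apply: (JD); apply: (JM). Qed.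

Lemma ideal3 J r a s b t e f :
  ideal J -> J a -> J b -> J e -> f = r * a + s * b + t * e -> J f.
Proof.
by move=> [_ [JD JM]] Ja Jb Je ->; apply: (JD); [apply: (JD)|]; apply: (JM).
Qed.

Lemma idealD J f g : ideal J -> J f -> J g -> J (f + g).
Proof. by case=> _ [JD _]; apply: JD. Qed.

Lemma idealMl J r f : ideal J -> J f -> J (r * f).
Proof. by case=> _ [_ JM]; apply: JM. Qed.

Lemma ideal_sum J n (F : 'I_n -> A) :
  ideal J -> (forall i, J (F i)) -> J (\sum_(i < n) F i).
Proof. by move=> [J0 [JD _]] JF; elim/big_ind: _. Qed.

Lemma ideal_zero : ideal (fun f => f = 0).
Proof.
by split=> //; split=> [f g -> ->|r f ->]; rewrite ?addr0 ?mulr0.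
Qed.

Lemma nzd_ext J K f : (forall g, J g <-> K g) -> nzd J f -> nzd K f.
Proof. by move=> JK Jf g /JK /Jf /JK. Qed.

Lemma adj_ideal J a : ideal J -> ideal (adj J a).
Proof.
move=> JJ; split; last split.
- by exists 0; rewrite mul0r subrr; case: JJ.
- move=> f g [c Jc] [d Jd]; exists (c + d).
  by apply: (ideal2 (r := 1) (s := 1) JJ Jc Jd); ring.
- by move=> r f [c Jc]; exists (r * c); apply: (ideal1 (r := r) JJ Jc); ring.
Qed.

Lemma adj_sub J a f : ideal J -> J f -> adj J a f.
Proof. by move=> JJ Jf; exists 0; apply: (ideal1 (r := 1) JJ Jf); ring. Qed.

Lemma adj_gen J a : ideal J -> adj J a a.
Proof. by move=> [J0 _]; exists 1; rewrite mul1r subrr. Qed.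

Lemma adj_mono J K a f : (forall g, J g -> K g) -> adj J a f -> adj K a f.
Proof. by move=> JK [c Jc]; exists c; apply: JK. Qed.

Lemma adjC J a b f : adj (adj J a) b f -> adj (adj J b) a f.
Proof. by move=> [c [d Jd]]; exists d, c; rewrite addrAC. Qed.

Lemma nzdM J f g : nzd J f -> nzd J g -> nzd J (f * g).
Proof. by move=> Jf Jg h; rewrite -mulrA => /Jf /Jg. Qed.

Lemma nzd1 J : nzd J 1.
Proof. by move=> f; rewrite mul1r. Qed.

Lemma nzd_prod (I : Type) (s : seq I) J (F : I -> A) :
  (forall i, nzd J (F i)) -> nzd J (\prod_(i <- s) F i).
Proof. by move=> JF; elim/big_ind: _ => //; [apply: nzd1|move=> *; apply: nzdM]. Qed.

Lemma nzdX J f n : nzd J f -> nzd J (f ^+ n).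
Proof.
by move=> Jf; elim: n => [|n IH]; [apply: nzd1|rewrite exprS; apply: nzdM].
Qed.

Lemma nzd_adj1 J x : ideal J -> nzd (adj J 1) x.
Proof. by move=> [J0 _] g _; exists g; rewrite mulr1 subrr. Qed.

(** Multiplication by [a] embeds A/(J + (b)) in A/(J + (ab)) with quotient A/(J + (a)), and [x] is
    regular on both ends. *)
Lemma nzd_adjM J a b x : ideal J -> nzd J a ->
  nzd (adj J a) x -> nzd (adj J b) x -> nzd (adj J (a * b)) x.
Proof.
move=> JJ Ja xa xb h [c Jc].
have [|c' Jc'] := xa h.
  by exists (c * b); apply: (ideal1 (r := 1) JJ Jc); ring.
have [|c'' Jc''] := xb c'.
  exists c; apply: Ja.
  by apply: (ideal2 (r := 1) (s := - x) JJ Jc Jc'); ring.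
by exists c''; apply: (ideal2 (r := 1) (s := a) JJ Jc' Jc''); ring.
Qed.

Lemma nzd_adj_prod (I : eqType) (s : seq I) J (F : I -> A) x : ideal J ->
  (forall i, i \in s -> nzd J (F i)) ->
  (forall i, i \in s -> nzd (adj J (F i)) x) ->
  nzd (adj J (\prod_(i <- s) F i)) x.
Proof.
move=> JJ; elim: s => [|i s IH] JF xF.
  by rewrite big_nil; apply: nzd_adj1.
rewrite big_cons; apply: nzd_adjM => //.
- by apply: JF; rewrite mem_head.
- by apply: xF; rewrite mem_head.
- by apply: IH => j js; [apply: JF|apply: xF]; rewrite inE js orbT.
Qed.

Lemma nzd_adjX J a n x : ideal J -> nzd J a ->
  nzd (adj J a) x -> nzd (adj J (a ^+ n)) x.
Proof.
move=> JJ Ja xa; elim: n => [|n IH]; first exact: nzd_adj1.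
by rewrite exprS; apply: nzd_adjM.
Qed.

(* [pw B a b m] is the ideal B + (a, b)^m; the recursion isolates the term
   b^m, the only generator of (a, b)^m that is not a multiple of a. *)
Fixpoint pw B a b m f : Prop :=
  if m is m'.+1 then
    exists g c, pw B a b m' g /\ B (f - (a * g + b ^+ m * c))
  else True.

Lemma pw_ideal B a b m : ideal B -> ideal (pw B a b m).
Proof.
move=> BB; elim: m => [|m IH] //=; split; last split.
- exists 0, 0; split; first by case: IH.
  by case: BB => B0 _; rewrite !mulr0 addr0 subr0.
- move=> f g [f' [c [pf Bf]]] [g' [d [pg Bg]]].
  exists (f' + g'), (c + d); split; first exact: idealD.
  by apply: (ideal2 (r := 1) (s := 1) BB Bf Bg); ring.
- move=> r f [f' [c [pf Bf]]]; exists (r * f'), (r * c); split.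
    exact: idealMl.
  by apply: (ideal1 (r := r) BB Bf); ring.
Qed.

Lemma pw_sub B a b m f : ideal B -> B f -> pw B a b m f.
Proof.
move=> BB Bf; case: m => //= m; exists 0, 0; split.
  by case: (pw_ideal a b m BB).
by rewrite !mulr0 addr0 subr0.
Qed.

Lemma pw_mulb B a b m f : ideal B -> pw B a b m f -> pw B a b m.+1 (b * f).
Proof.
move=> BB; elim: m f => [|m IH] f.
  by move=> _; exists 0, f; split=> //; rewrite mulr0 add0r expr1 subrr; case: BB.
move=> [g [c [pg Bg]]]; exists (b * g), c; split; first exact: IH.
by apply: (ideal1 (r := b) BB Bg); rewrite (exprS _ m.+1); ring.
Qed.

Lemma pw_mula B a b m f : ideal B -> pw B a b m f -> pw B a b m.+1 (a * f).
Proof.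
move=> [B0 _] pf; exists f, 0; split=> //.
by rewrite mulr0 addr0 subrr.
Qed.

Lemma pw_mulX B a b i j f : ideal B -> pw B a b (i + j) (a ^+ i * b ^+ j * f).
Proof.
move=> BB; elim: i => [|i IH].
  rewrite add0n expr0 mul1r; elim: j => [|j IH] //.
  by rewrite exprS -mulrA; apply: pw_mulb.
by rewrite addSn exprS -!mulrA; apply: pw_mula => //; rewrite mulrA.
Qed.

Lemma pw_leq B a b m n f : ideal B -> (n <= m)%N -> pw B a b m f -> pw B a b n f.
Proof.
move=> BB; elim: m n f => [|m IH] [|n] f //= le_nm.
move=> [g [c [pg Bg]]].
have := pw_sub a b n.+1 BB Bg.
have pag : pw B a b n.+1 (a * g) by apply: pw_mula => //; apply: IH.
have pbc : pw B a b n.+1 (b ^+ m.+1 * c).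
  have := pw_mulX a b 0 n.+1 (b ^+ (m - n) * c) BB.
  by rewrite add0n expr0 mul1r mulrA -exprD addSn subnKC.
move=> pf; apply: (ideal3 (r := 1) (s := 1) (t := 1) (pw_ideal a b n.+1 BB) pf pag pbc).
ring.
Qed.

Lemma pw_min B a b m K f : ideal B -> ideal K -> (forall g, B g -> K g) ->
  (forall i j, (i + j = m)%N -> K (a ^+ i * b ^+ j)) -> pw B a b m f -> K f.
Proof.
move=> BB; elim: m K f => [|m IH] K f KK BK Kab.
  by move=> _; apply: (ideal1 (r := f) KK (Kab 0 0 erefl)%N); ring.
move=> [g [c [pg Bg]]].
(* The induction hypothesis is applied to the colon ideal K : a. *)
have Kag : K (a * g).
  apply: (IH (fun h => K (a * h))) pg.
  - split; first by rewrite mulr0; case: KK.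
    split=> [h h' Kh Kh'|r h Kh]; first by rewrite mulrDr; apply: idealD.
    by rewrite mulrCA; apply: idealMl.
  - by move=> h Bh; apply: idealMl => //; apply: BK.
  - by move=> i j ij; rewrite mulrA -exprS; apply: Kab; rewrite -ij.
apply: (ideal3 (r := 1) (s := 1) (t := c) KK (BK _ Bg) Kag (Kab 0 m.+1 erefl)%N).
by ring.
Qed.

Lemma pwC B a b m f : ideal B -> pw B a b m f -> pw B b a m f.
Proof.
move=> BB; apply: pw_min => //; first exact: pw_ideal.
  by move=> g; apply: pw_sub.
move=> i j ij; rewrite -[_ * _]mulr1 [a ^+ i * _]mulrC -ij addnC.
exact: pw_mulX.
Qed.

Lemma pw_dvd B a a' b b' m f : ideal B ->
  pw B (a * a') (b * b') m f -> pw B a b m f.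
Proof.
move=> BB; apply: pw_min => //; first exact: pw_ideal.
  by move=> g; apply: pw_sub.
move=> i j <-; rewrite !exprMn.
have -> : a ^+ i * a' ^+ i * (b ^+ j * b' ^+ j) =
  a ^+ i * b ^+ j * (a' ^+ i * b' ^+ j) by ring.
exact: pw_mulX.
Qed.

(** Used to replace the base zero by ([linf]) when powers are reduced modulo [linf]. *)
Lemma pw_base B J a b m f : ideal B -> ideal J -> (forall g, B g -> J g) ->
  pw J a b m f <-> exists g, pw B a b m g /\ J (f - g).
Proof.
move=> BB JJ BJ; split=> [|[g [pg Jg]]]; last first.
  have pJg : pw J a b m g.
    apply: pw_min pg => //; first exact: pw_ideal.
      by move=> h Bh; apply: pw_sub => //; apply: BJ.
    by move=> i j <-; rewrite -[_ * _]mulr1; apply: pw_mulX.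
  have pfg := pw_sub a b m JJ Jg.
  by apply: (ideal2 (r := 1) (s := 1) (pw_ideal a b m JJ) pJg pfg); ring.
pose K h := exists g, pw B a b m g /\ J (h - g).
apply: (@pw_min _ _ _ _ K) => //.
- split; last split.
  + exists 0; split; first by case: (pw_ideal a b m BB).
    by rewrite subr0; case: JJ.
  + move=> h h' [g [pg Jg]] [g' [pg' Jg']]; exists (g + g'); split.
      by apply: idealD => //; apply: pw_ideal.
    by apply: (ideal2 (r := 1) (s := 1) JJ Jg Jg'); ring.
  + move=> r h [g [pg Jg]]; exists (r * g); split.
      by apply: idealMl => //; apply: pw_ideal.
    by apply: (ideal1 (r := r) JJ Jg); ring.
- move=> h Jh; exists 0; split; first by case: (pw_ideal a b m BB).
  by rewrite subr0.
- move=> i j ij; exists (a ^+ i * b ^+ j); split.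
    by rewrite -ij -[_ * _]mulr1; apply: pw_mulX.
  by rewrite subrr; case: JJ.
Qed.

(** If a(f - g) = b^(m+1) c modulo [B], regularity of [b] modulo [a] makes [c] a multiple of [a],
    and then [a] cancels. *)
Lemma pw_colon B a b m f : ideal B -> nzd B a -> nzd (adj B a) b ->
  pw B a b m.+1 (a * f) -> pw B a b m f.
Proof.
move=> BB Ba Bb [g [c [pg Bg]]].
have [|c' Bc'] := nzdX (n := m.+1) Bb (g := c).
  exists (f - g); by apply: (ideal1 (r := -1) BB Bg); ring.
have Bf : B (f - g - b ^+ m.+1 * c').
  by apply: Ba; apply: (ideal2 (r := 1) (s := b ^+ m.+1) BB Bg Bc'); ring.
have pc : pw B a b m (b ^+ m.+1 * c').
  by apply: (pw_leq BB (leqnSn m)); have := pw_mulX a b 0 m.+1 c' BB; rewrite add0n expr0 mul1r.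
apply: (ideal3 (r := 1) (s := 1) (t := 1) (pw_ideal a b m BB) pg pc (pw_sub a b m BB Bf)).
ring.
Qed.

(** Induction on [m]: modulo [a], [u] is regular modulo b^(m+1), which gives h = b^(m+1) c' + a d;
    then a u d lies in the (m+1)-st power and [pw_colon] lowers the exponent. *)
Lemma nzd_pw B a b m u : ideal B -> nzd B a -> nzd (adj B a) b ->
  nzd (adj (adj B a) b) u -> nzd (pw B a b m) u.
Proof.
move=> BB Ba Bb Bu; elim: m => [|m IH] h //.
move=> puh; have [g [c [pg Bg]]] := puh.
have [|c' [d Bd]] := nzd_adjX (n := m.+1) (adj_ideal a BB) Bb Bu (g := h).
  by exists c, g; apply: (ideal1 (r := 1) BB Bg); ring.
exists d, c'; split; last by apply: (ideal1 (r := 1) BB Bd); ring.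
apply: IH; apply: pw_colon => //.
have pb : pw B a b m.+1 (b ^+ m.+1 * (u * c')).
  by have := pw_mulX a b 0 m.+1 (u * c') BB; rewrite add0n expr0 mul1r.
apply: (ideal3 (r := 1) (s := -1) (t := - u) (pw_ideal a b m.+1 BB) puh pb
  (pw_sub a b m.+1 BB Bd)).
ring.
Qed.

(** Modulo [a] only the terms b^(m+1) c and b'^(m+1) c' remain, and their equality makes [c]
    divisible by b'^(m+1). What is left is a multiple of [a], to which [pw_colon] and induction
    apply. *)
Lemma pw_inter B a b b' m f : ideal B -> nzd B a ->
  nzd (adj B a) b -> nzd (adj B a) b' -> nzd (adj (adj B a) b') b ->
  pw B a b m f -> pw B a b' m f -> pw B a (b * b') m f.
Proof.
move=> BB Ba ab ab' abb'; elim: m f => [|m IH] f //.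
move=> pf pf'; have [g [c [pg Bg]]] := pf; have [g' [c' [pg' Bg']]] := pf'.
have bm := nzdX (n := m.+1) (nzd_adjX (n := m.+1) (adj_ideal a BB) ab' abb').
have [|e [d Bd]] := bm c.
  exists c', (g' - g); apply: (ideal2 (r := 1) (s := -1) BB Bg' Bg); ring.
have Bf : B (f - (a * (g + b ^+ m.+1 * d) + (b * b') ^+ m.+1 * e)).
  apply: (ideal2 (r := 1) (s := b ^+ m.+1) BB Bg Bd).
  by rewrite exprMn; ring.
exists (g + b ^+ m.+1 * d), e; split=> //.
(* The cofactor of [a] lies in both powers of exponent [m]; [x] stands for [b] and then for [b']. *)
have aux x y : nzd (adj B a) x -> (b * b') ^+ m.+1 = x ^+ m.+1 * y ^+ m.+1 ->
    pw B a x m.+1 f -> pw B a x m (g + b ^+ m.+1 * d).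
  move=> ax xy pfx; apply: pw_colon => //.
  have px : pw B a x m.+1 (x ^+ m.+1 * (y ^+ m.+1 * e)).
    by have := pw_mulX a x 0 m.+1 (y ^+ m.+1 * e) BB; rewrite add0n expr0 mul1r.
  apply: (ideal3 (r := 1) (s := -1) (t := -1) (pw_ideal a x m.+1 BB) pfx px
    (pw_sub a x m.+1 BB Bf)).
  by rewrite xy; ring.
apply: IH; first by apply: (aux b b'); rewrite // exprMn.
by apply: (aux b' b); rewrite // exprMn mulrC.
Qed.

Lemma pw1 B a m f : ideal B -> pw B a 1 m f.
Proof.
move=> BB; have := pw_mulX a 1 0 m f BB.
by rewrite add0n expr0 mul1r expr1n mul1r.
Qed.

Lemma pw_inter_prod (I : eqType) (s : seq I) B a (F : I -> A) m f :
  uniq s -> ideal B -> nzd B a ->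
  (forall i, i \in s -> nzd (adj B a) (F i)) ->
  (forall i j, i \in s -> j \in s -> i != j -> nzd (adj (adj B a) (F j)) (F i)) ->
  (forall i, i \in s -> pw B a (F i) m f) -> pw B a (\prod_(i <- s) F i) m f.
Proof.
move=> us BB Ba; elim: s us => [|i s IH] /= us aF FF pF.
  by rewrite big_nil; apply: pw1.
case/andP: us => nis us; rewrite big_cons.
have sub j : j \in s -> j \in i :: s by rewrite inE orbC => ->.
have ii : i \in i :: s by rewrite mem_head.
apply: pw_inter => //; try exact: aF.
- by rewrite big_seq; elim/big_ind: _; [apply: nzd1|move=> *; apply: nzdM|move=> j /sub /aF].
- apply: nzd_adj_prod; first exact: adj_ideal.
    by move=> j /sub /aF.
  move=> j js; apply: FF => //; first exact: sub.
  by apply: contra nis => /eqP ->.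
- exact: pF.
- by apply: IH => //; [move=> j /sub /aF|move=> j j' /sub ? /sub ?; apply: FF|move=> j /sub /pF].
Qed.

Lemma nzd_pw_prod (I I' : eqType) (s : seq I) (t : seq I') B
    (F : I -> A) (G : I' -> A) m u : ideal B ->
  (forall i, nzd B (F i)) -> (forall j, nzd B (G j)) ->
  (forall i j, nzd (adj B (F i)) (G j)) -> (forall i j, nzd (adj B (G j)) (F i)) ->
  (forall i j, nzd (adj (adj B (F i)) (G j)) u) ->
  nzd (pw B (\prod_(i <- s) F i) (\prod_(j <- t) G j) m) u.
Proof.
move=> BB BF BG FG GF uFG; apply: nzd_pw => //; first exact: nzd_prod.
  by apply: nzd_prod => j; apply: nzd_adj_prod.
apply: nzd_adj_prod; first exact: adj_ideal.
  by move=> j _; apply: nzd_adj_prod.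
move=> j _; apply: (@nzd_ext (adj (adj B (G j)) (\prod_(i <- s) F i))).
  by move=> g; split; apply: adjC.
apply: nzd_adj_prod; [exact: adj_ideal|by []|move=> i _].
by apply: nzd_ext (uFG i j) => g; split; apply: adjC.
Qed.

Lemma nzd_adjXX J f1 f2 n : ideal J -> nzd J f1 -> nzd (adj J f1) f2 ->
  nzd (adj J (f1 ^+ n)) (f2 ^+ n).
Proof. by move=> JJ J1 J2; apply: nzdX; apply: nzd_adjX. Qed.

(* With M g = L h modulo J, the fraction g / L = h / M is a section on the locus
   where L or M is invertible; multiplied by a power of f1 or f2 it becomes
   regular, and as f1, f2 is a regular sequence it was regular all along. *)
Lemma nzd_adj_of_regular J f1 f2 L M n : ideal J ->
  nzd J f1 -> nzd (adj J f1) f2 ->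
  adj (adj J L) M (f1 ^+ n) -> adj (adj J L) M (f2 ^+ n) -> nzd (adj J L) M.
Proof.
move=> JJ J1 J2 [b1 [a1 E1]] [b2 [a2 E2]] g [h Jh].
have reg1 := nzdX (n := n) J1; have reg2 := nzd_adjXX (n := n) JJ J1 J2.
move: (f1 ^+ n) (f2 ^+ n) E1 E2 reg1 reg2 => F1 F2 E1 E2 reg1 reg2.
pose p1 := a1 * g + b1 * h; pose p2 := a2 * g + b2 * h.
have L1 : J (L * p1 - F1 * g).
  by apply: (ideal2 (r := - b1) (s := - g) JJ Jh E1); rewrite /p1; ring.
have M1 : J (M * p1 - F1 * h).
  by apply: (ideal2 (r := a1) (s := - h) JJ Jh E1); rewrite /p1; ring.
have L2 : J (L * p2 - F2 * g).
  by apply: (ideal2 (r := - b2) (s := - g) JJ Jh E2); rewrite /p2; ring.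
have M2 : J (M * p2 - F2 * h).
  by apply: (ideal2 (r := a2) (s := - h) JJ Jh E2); rewrite /p2; ring.
pose D := F2 * p1 - F1 * p2.
have LD : J (L * D).
  by apply: (ideal2 (r := F2) (s := - F1) JJ L1 L2); rewrite /D; ring.
have MD : J (M * D).
  by apply: (ideal2 (r := F2) (s := - F1) JJ M1 M2); rewrite /D; ring.
have JD : J D.
  by apply: reg1; apply: (ideal3 (r := D) (s := a1) (t := b1) JJ E1 LD MD); ring.
have [|q Jq] := reg2 p1.
  by exists p2; apply: (ideal1 (r := 1) JJ JD); rewrite /D; ring.
exists q; apply: reg1.
by apply: (ideal2 (r := -1) (s := L) JJ L1 Jq); ring.
Qed.

(** Koszul-type elimination: with fi s = bi M + ai L modulo [J], regularity of f1, f2, f3 makes the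
    relations among these equations trivial, so f1 can be cancelled from the first. This is the
    source of the upper bound on the depth. *)
Lemma depth_le2 J L M f1 f2 f3 s : ideal J -> nzd J L -> nzd (adj J L) M ->
  nzd J f1 -> nzd (adj J f1) f2 -> nzd (adj (adj J f1) f2) f3 ->
  adj (adj J L) M (f1 * s) -> adj (adj J L) M (f2 * s) ->
  adj (adj J L) M (f3 * s) -> adj (adj J L) M s.
Proof.
move=> JJ JL JM J1 J2 J3 [b1 [a1 E1]] [b2 [a2 E2]] [b3 [a3 E3]].
(* Eliminating [s] from two of the equations gives a relation between [L] and [M] modulo [J], and
   such relations are multiples of the Koszul one. *)
have cross fi fj ai aj bi bj :
    J (fi * s - bi * M - ai * L) -> J (fj * s - bj * M - aj * L) ->
    exists c, J (fj * bi - fi * bj - c * L) /\ J (fj * ai - fi * aj + c * M).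
  move=> Ei Ej; have [|c Jc] := JM (fj * bi - fi * bj).
    exists (- (fj * ai - fi * aj)).
    by apply: (ideal2 (r := - fj) (s := fi) JJ Ei Ej); ring.
  exists c; split; first by apply: (ideal1 (r := 1) JJ Jc); ring.
  apply: JL; apply: (ideal3 (r := - fj) (s := fi) (t := - M) JJ Ei Ej Jc); ring.
have [c12 [B12 A12]] := cross _ _ _ _ _ _ E1 E2.
have [c23 [B23 _]] := cross _ _ _ _ _ _ E2 E3.
have [c31 [B31 _]] := cross _ _ _ _ _ _ E3 E1.
(* In the cyclic sum of the relations all bi cancel, leaving [L] times this combination. *)
have Jc : J (f3 * c12 + f1 * c23 + f2 * c31).
  apply: JL; apply: (ideal3 (r := - f3) (s := - f1) (t := - f2) JJ B12 B23 B31); ring.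
have [|t [r Jt]] := J3 c12.
  by exists (- c31), (- c23); apply: (ideal1 (r := 1) JJ Jc); ring.
have [|w Jw] := J2 (b1 - t * L).
  exists (b2 + r * L).
  by apply: (ideal2 (r := 1) (s := L) JJ B12 Jt); ring.
have [|w' Jw'] := J2 (a1 + t * M).
  exists (a2 - r * M).
  by apply: (ideal2 (r := 1) (s := - M) JJ A12 Jt); ring.
exists w, w'; apply: J1.
apply: (ideal3 (r := 1) (s := M) (t := L) JJ E1 Jw Jw'); ring.
Qed.

Lemma radicalD J f g m n : ideal J -> J (f ^+ m) -> J (g ^+ n) ->
  J ((f + g) ^+ (m + n)).
Proof.
move=> JJ Jf Jg; rewrite exprDn; apply: ideal_sum => // i.
rewrite -mulr_natl; apply: idealMl => //.
case: (leqP n i) => [le_ni|lt_in].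
  by rewrite -(subnK le_ni) exprD mulrA; apply: idealMl.
have le : (m <= m + n - i)%N by lia.
rewrite -(subnK le) exprD.
by apply: (ideal1 (r := f ^+ (m + n - i - m) * g ^+ i) JJ Jf); ring.
Qed.

End IdealCalculus.

(** * Linear forms on the two factors *)

Section Coordinates.
Variables (k : closedFieldType) (c : k).
Notation R := {mpoly k[4]}.
Notation x0 := (@x0 k).
Notation x1 := (@x1 k).
Notation y0 := (@y0 k).
Notation y1 := (@y1 k).
Implicit Types (J : R -> Prop) (f g u : R).

(** For suitable [c] the lines [linf = 0] and [minf = 0] miss all points of the scheme and become
    the lines at infinity of an affine chart; one [c] serves both factors. *)
Definition linf : R := x1 - c%:MP * x0.
Definition minf : R := y1 - c%:MP * y0.
Definition lx (a : k) : R := x0 - a%:MP * linf.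
Definition ly (b : k) : R := y0 - b%:MP * minf.

(** The forms [x0], [linf], [y0], [minf] are again coordinates on R, so ring identities are checked
    on them and on constants. *)
Lemma mpoly4_ind (P : R -> Prop) :
  (forall a, P a%:MP) -> (forall f g, P f -> P g -> P (f + g)) ->
  (forall f g, P f -> P g -> P (f * g)) ->
  P x0 -> P linf -> P y0 -> P minf -> forall f, P f.
Proof.
move=> PC PD PM Px0 PL Py0 PN f.
have Px1 : P x1.
  by rewrite (_ : x1 = linf + c%:MP * x0); [apply: (PD) => //; apply: (PM)|rewrite /linf; ring].
have Py1 : P y1.
  by rewrite (_ : y1 = minf + c%:MP * y0); [apply: (PD) => //; apply: (PM)|rewrite /minf; ring].
have PX (i : 'I_4) : P 'X_i.
  case: i => [[|[|[|[|//]]]]] i_lt.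
  - by rewrite (_ : Ordinal i_lt = i0) //; apply: val_inj.
  - by rewrite (_ : Ordinal i_lt = i1) //; apply: val_inj.
  - by rewrite (_ : Ordinal i_lt = i2) //; apply: val_inj.
  - by rewrite (_ : Ordinal i_lt = i3) //; apply: val_inj.
rewrite (mpolyE f); elim/big_ind: _ => [||mo _]; [exact: (PC 0)|exact: (PD)|].
rewrite -mul_mpolyC; apply: (PM) => //; rewrite mpolyXE_id.
elim/big_ind: _ => [||i _]; [exact: (PC 1)|exact: (PM)|].
by elim: (mo i) => [|n IH]; [exact: (PC 1)|rewrite exprS; apply: (PM)].
Qed.

Section Substitution.
Variables (A : comNzRingType) (h : {rmorphism k -> A}).

(* the k-algebra morphism with x0, linf, y0, minf |-> p, l, q, m *)
Definition subst (p l q m : A) : R -> A :=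
  mmap h (fun i : 'I_4 => [:: p; l + h c * p; q; m + h c * q]`_i).

HB.instance Definition _ p l q m := GRing.RMorphism.on (subst p l q m).

Variables p l q m : A.
Notation S := (subst p l q m).

Lemma substC a : S a%:MP = h a.
Proof. exact: mmapC. Qed.

Lemma substx0 : S x0 = p.
Proof. by rewrite /subst mmapX mmap1U. Qed.

Lemma substx1 : S x1 = l + h c * p.
Proof. by rewrite /subst mmapX mmap1U. Qed.

Lemma substy0 : S y0 = q.
Proof. by rewrite /subst mmapX mmap1U. Qed.

Lemma substy1 : S y1 = m + h c * q.
Proof. by rewrite /subst mmapX mmap1U. Qed.

Lemma subst_linf : S linf = l.
Proof. by rewrite rmorphB rmorphM /= substC substx0 substx1 addrK. Qed.

Lemma subst_minf : S minf = m.
Proof. by rewrite rmorphB rmorphM /= substC substy0 substy1 addrK. Qed.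

Lemma subst_lx a : S (lx a) = p - h a * l.
Proof. by rewrite rmorphB rmorphM /= substC substx0 subst_linf. Qed.

Lemma subst_ly b : S (ly b) = q - h b * m.
Proof. by rewrite rmorphB rmorphM /= substC substy0 subst_minf. Qed.

Definition substE :=
  (substC, substx0, substy0, subst_linf, subst_minf, subst_lx, subst_ly).

End Substitution.

Notation endo := (subst (@mpolyC 4 k)).

Lemma endo_congr J p l q m f : ideal J ->
  J (x0 - p) -> J (linf - l) -> J (y0 - q) -> J (minf - m) ->
  J (f - endo p l q m f).
Proof.
move=> JJ Jx JL Jy JN; elim/mpoly4_ind: f => [a|f g Jf Jg|f g Jf Jg||||];
  rewrite ?substE ?rmorphD ?rmorphM //=.
- by rewrite subrr; case: JJ.
- by apply: (ideal2 (r := 1) (s := 1) JJ Jf Jg); ring.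
- by apply: (ideal2 (r := g) (s := endo p l q m f) JJ Jf Jg); ring.
Qed.

Lemma subst_neq0 (p l q m : k) f : subst idfun p l q m f != 0 -> f != 0.
Proof. by apply: contraNneq => ->; rewrite rmorph0. Qed.

Lemma linf_neq0 : linf != 0.
Proof. by apply: (@subst_neq0 0 1 0 0); rewrite substE oner_neq0. Qed.

Lemma minf_neq0 : minf != 0.
Proof. by apply: (@subst_neq0 0 0 0 1); rewrite substE oner_neq0. Qed.

Lemma x0_neq0 : x0 != 0.
Proof. by apply: (@subst_neq0 1 0 0 0); rewrite substE oner_neq0. Qed.

Lemma lx_neq0 a : lx a != 0.
Proof. by apply: (@subst_neq0 1 0 0 0); rewrite substE mulr0 subr0 oner_neq0. Qed.

Lemma ly_neq0 b : ly b != 0.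
Proof. by apply: (@subst_neq0 0 0 1 0); rewrite substE mulr0 subr0 oner_neq0. Qed.

Definition zid f := f = 0.

Lemma zid_ideal : ideal zid.
Proof. exact: ideal_zero. Qed.

Lemma nzd_zid u : u != 0 -> nzd zid u.
Proof. by move=> u0 g /eqP; rewrite mulf_eq0 (negPf u0) => /eqP. Qed.

(* Under these hypotheses J is the kernel of a ring endomorphism of R, hence prime. *)
Lemma nzd_endo J p l q m u : ideal J ->
  J (x0 - p) -> J (linf - l) -> J (y0 - q) -> J (minf - m) ->
  (forall f, J f -> endo p l q m f = 0) -> endo p l q m u != 0 -> nzd J u.
Proof.
move=> JJ Jx JL Jy JN J0 u0 g /J0; rewrite rmorphM => /eqP.
rewrite mulf_eq0 (negPf u0) => /eqP g0.
by have := endo_congr g JJ Jx JL Jy JN; rewrite g0 subr0.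
Qed.

Lemma adj_ker J (A : nzRingType) (phi : {rmorphism R -> A}) a :
  (forall f, J f -> phi f = 0) -> phi a = 0 -> forall f, adj J a f -> phi f = 0.
Proof.
move=> J0 a0 f [d /J0]; rewrite rmorphB rmorphM a0 mulr0 subr0 //.
Qed.

Lemma zid_ker (A : nzRingType) (phi : {rmorphism R -> A}) f : zid f -> phi f = 0.
Proof. by move=> ->; rewrite rmorph0. Qed.

Lemma ideal_subrr J f : ideal J -> J (f - f).
Proof. by rewrite subrr; case. Qed.

Lemma sub_lx_lx a a' : a != a' -> a%:MP * linf - a'%:MP * linf != 0.
Proof.
move=> aa'; rewrite -mulrBl mulf_neq0 ?linf_neq0 //.
by rewrite -rmorphB /= mpolyC_eq0 subr_eq0.
Qed.

Lemma sub_ly_ly b b' : b != b' -> b%:MP * minf - b'%:MP * minf != 0.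
Proof.
move=> bb'; rewrite -mulrBl mulf_neq0 ?minf_neq0 //.
by rewrite -rmorphB /= mpolyC_eq0 subr_eq0.
Qed.

Ltac idl := by repeat apply: adj_ideal; exact: zid_ideal.

Ltac adj_mem := first
  [ by apply: ideal_subrr; idl
  | by rewrite ?subr0; apply: adj_gen; idl
  | by apply: adj_sub; [idl | adj_mem] ].

Ltac adj_zero := first
  [ exact: zid_ker
  | by apply: adj_ker; [adj_zero | rewrite /= !substE ?mulr0 ?subrr] ].

(** Presents the ideal as the kernel of the substitution with values [p], [l], [q], [m], which
    leaves only the image of the element to be shown nonzero. *)
Ltac nzd_by p l q m :=
  apply: (@nzd_endo _ p l q m);
  [ idl | try adj_mem | try adj_mem | try adj_mem | try adj_mem
  | try (move=> ?; adj_zero) | rewrite !substE /= ].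

Lemma nzd_lx_ly a b : nzd (adj zid (lx a)) (ly b).
Proof. by nzd_by (a%:MP * linf) linf (y0 : R) minf; exact: ly_neq0. Qed.

Lemma nzd_ly_lx a b : nzd (adj zid (ly b)) (lx a).
Proof. by nzd_by (x0 : R) linf (b%:MP * minf) minf; exact: lx_neq0. Qed.

Lemma nzd_pt_linf a b : nzd (adj (adj zid (lx a)) (ly b)) linf.
Proof. by nzd_by (a%:MP * linf) linf (b%:MP * minf) minf; exact: linf_neq0. Qed.

Lemma nzd_pt_lx a b a' : a != a' -> nzd (adj (adj zid (lx a)) (ly b)) (lx a').
Proof.
move=> aa'; nzd_by (a%:MP * linf) linf (b%:MP * minf) minf; exact: sub_lx_lx.
Qed.

Lemma nzd_pt_ly a b b' : b != b' -> nzd (adj (adj zid (lx a)) (ly b)) (ly b').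
Proof.
move=> bb'; nzd_by (a%:MP * linf) linf (b%:MP * minf) minf; exact: sub_ly_ly.
Qed.

Lemma nzd_linf_lx a : nzd (adj zid linf) (lx a).
Proof. by nzd_by (x0 : R) (0 : R) (y0 : R) minf; rewrite mulr0 subr0 x0_neq0. Qed.

Lemma nzd_linf_ly b : nzd (adj zid linf) (ly b).
Proof. by nzd_by (x0 : R) (0 : R) (y0 : R) minf; exact: ly_neq0. Qed.

Lemma adj_linf_lx a : adj (adj zid linf) (lx a) (x0 - 0).
Proof. by exists 1, a%:MP; rewrite /zid /lx; ring. Qed.

Lemma nzd_linf_lx_ly a b : nzd (adj (adj zid linf) (lx a)) (ly b).
Proof.
nzd_by (0 : R) (0 : R) (y0 : R) minf; first exact: adj_linf_lx.
exact: ly_neq0.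
Qed.

Lemma nzd_linf_ly_lx a b : nzd (adj (adj zid linf) (ly b)) (lx a).
Proof.
by nzd_by (x0 : R) (0 : R) (b%:MP * minf) minf; rewrite mulr0 subr0 x0_neq0.
Qed.

Lemma nzd_linf_pt_minf a b : nzd (adj (adj (adj zid linf) (lx a)) (ly b)) minf.
Proof.
nzd_by (0 : R) (0 : R) (b%:MP * minf) minf; last exact: minf_neq0.
by apply: adj_sub; [idl | exact: adj_linf_lx].
Qed.

Definition Fx (s : seq k) : R := \prod_(a <- s) lx a.
Definition Gy (t : seq k) : R := \prod_(b <- t) ly b.

Lemma nzd_grid_linf s t m : nzd (pw zid (Fx s) (Gy t) m) linf.
Proof.
apply: nzd_pw_prod; first exact: zid_ideal.
- by move=> a; apply/nzd_zid/lx_neq0.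
- by move=> b; apply/nzd_zid/ly_neq0.
- exact: nzd_lx_ly.
- exact: nzd_ly_lx.
- exact: nzd_pt_linf.
Qed.

Lemma nzd_grid_minf s t m : nzd (adj (pw zid (Fx s) (Gy t) m) linf) minf.
Proof.
(* Adding [linf] to the power is the same as forming the power over the base ([linf]), where the
   product criterion applies. *)
apply: (@nzd_ext _ (pw (adj zid linf) (Fx s) (Gy t) m)).
  move=> f; split.
    move/(pw_base _ _ _ _ zid_ideal (adj_ideal linf zid_ideal)).
    move=> []; first by move=> g; apply: adj_sub; exact: zid_ideal.
    move=> g [pg [d fd]]; exists d; rewrite /zid in fd.
    by rewrite (_ : f - d * linf = g) //; apply/eqP; rewrite -subr_eq0 -{}fd; apply/eqP; ring.
  move=> [d pd].
  apply/(pw_base _ _ _ _ zid_ideal (adj_ideal linf zid_ideal)).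
    by move=> g; apply: adj_sub; exact: zid_ideal.
  by exists (f - d * linf); split=> //; exists d; rewrite /zid; ring.
apply: nzd_pw_prod; first idl.
- exact: nzd_linf_lx.
- exact: nzd_linf_ly.
- exact: nzd_linf_lx_ly.
- by move=> a b; apply: nzd_linf_ly_lx.
- exact: nzd_linf_pt_minf.
Qed.

Lemma Gy_neq0 t : Gy t != 0.
Proof. by rewrite prodf_seq_neq0; apply/allP => b _ /=; apply: ly_neq0. Qed.

(** Intersect over the columns for each fixed row, then over the rows; [pwC] exchanges the two
    generators in between. *)
Lemma pw_grid s t m f : uniq s -> uniq t ->
  (forall a b, a \in s -> b \in t -> pw zid (lx a) (ly b) m f) ->
  pw zid (Fx s) (Gy t) m f.
Proof.
move=> us ut pf; apply: pwC; first exact: zid_ideal.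
apply: pw_inter_prod => //; first exact: zid_ideal.
- exact/nzd_zid/Gy_neq0.
- move=> a _; apply: nzd_adj_prod => [||b _]; first exact: zid_ideal.
    by move=> b _; apply/nzd_zid/ly_neq0.
  exact: nzd_ly_lx.
- move=> a a' _ _ aa'; apply: (@nzd_ext _ (adj (adj zid (lx a')) (Gy t))).
    by move=> g; split; apply: adjC.
  apply: nzd_adj_prod; first idl.
    by move=> b _; apply: nzd_lx_ly.
  by move=> b _; apply: nzd_pt_lx; rewrite eq_sym.
move=> a ain; apply: pwC; first exact: zid_ideal.
apply: pw_inter_prod => //; first exact: zid_ideal.
- exact/nzd_zid/lx_neq0.
- by move=> b _; apply: nzd_lx_ly.
- by move=> b b' _ _ bb'; apply: nzd_pt_ly; rewrite eq_sym.
by move=> b bin; apply: pf.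
Qed.

End Coordinates.

(** * Passage to an affine chart *)

Section Bridge.
Variable k : closedFieldType.
Notation R := {mpoly k[4]}.
Implicit Types (I J K : R -> Prop) (f g u : R).

Lemma gen_ideal_nil f : gen_ideal [::] f <-> f = 0.
Proof.
split=> [[d ->]|->]; first by rewrite big_ord0.
by exists (fun _ => 0); rewrite big_ord0.
Qed.

Lemma gen_ideal_cons a gs f :
  gen_ideal (a :: gs) f <-> exists d, gen_ideal gs (f - d * a).
Proof.
split=> [[d ->]|[d [e fe]]].
  exists (d ord0), (fun i => d (lift ord0 i)).
  by rewrite big_ord_recl /= addrC addKr.
exists (fun i => if unlift ord0 i is Some j then e j else d).
rewrite big_ord_recl /= unlift_none -[LHS](subrK (d * a)) fe addrC.
by congr (_ + _); apply: eq_bigr => i _; rewrite liftK.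
Qed.

Lemma gen_ideal_ideal gs : ideal (gen_ideal gs : R -> Prop).
Proof.
elim: gs => [|a gs IH].
  have [Z0 [ZD ZM]] := ideal_zero R.
  split; [exact/gen_ideal_nil|split=> [f g|r f]].
    by move=> /gen_ideal_nil ? /gen_ideal_nil ?; apply/gen_ideal_nil/ZD.
  by move=> /gen_ideal_nil ?; apply/gen_ideal_nil/ZM.
have [Z0 [ZD ZM]] := adj_ideal a IH.
split; [exact/gen_ideal_cons|split=> [f g|r f]].
  by move=> /gen_ideal_cons ? /gen_ideal_cons ?; apply/gen_ideal_cons/ZD.
by move=> /gen_ideal_cons ?; apply/gen_ideal_cons/ZM.
Qed.

Lemma gen_ideal_mem gs g : g \in gs -> gen_ideal gs g.
Proof.
elim: gs => // a gs IH; rewrite inE => /orP [/eqP ->|/IH gg]; apply/gen_ideal_cons.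
  by exists 1; rewrite mul1r subrr; case: (gen_ideal_ideal gs).
by exists 0; rewrite mul0r subr0.
Qed.

Lemma gen_ideal_min gs J f : ideal J -> (forall g, g \in gs -> J g) ->
  gen_ideal gs f -> J f.
Proof.
move=> JJ Jgs [d ->]; apply: ideal_sum => // i; apply: idealMl => //.
by apply: Jgs; rewrite mem_nth.
Qed.

Lemma gen_ideal2 a b f : gen_ideal [:: a; b] f <-> adj (adj (@zid k) a) b f.
Proof.
split=> [|/adjC].
  move/gen_ideal_cons=> [d /gen_ideal_cons [e /gen_ideal_nil fe]].
  by apply: adjC; exists d, e.
move=> [d [e fe]]; apply/gen_ideal_cons; exists d; apply/gen_ideal_cons; exists e.
exact/gen_ideal_nil.
Qed.

Lemma ideal_add_gen_nil I f : ideal I -> ideal_add_gen I [::] f <-> I f.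
Proof.
move=> II; split=> [[g [d [Ig [-> /gen_ideal_nil ->]]]]|If]; first by rewrite addr0.
by exists f, 0; rewrite addr0; do !split => //; apply/gen_ideal_nil.
Qed.

Lemma ideal_add_gen_cons I a gs f :
  ideal_add_gen I (a :: gs) f <-> ideal_add_gen (adj I a) gs f.
Proof.
split=> [[g [d [Ig [-> /gen_ideal_cons [e de]]]]]|[g [d [[e Ie] [-> gd]]]]].
  exists (g + e * a), (d - e * a); split; first by exists e; rewrite addrK.
  by split=> //; ring.
exists (g - e * a), (d + e * a); split=> //; split; first by ring.
by apply/gen_ideal_cons; exists e; rewrite addrK.
Qed.

Lemma ideal_add_gen1 I a f : ideal I -> ideal_add_gen I [:: a] f <-> adj I a f.
Proof.
move=> II; split.
  by move/ideal_add_gen_cons/ideal_add_gen_nil; apply; apply: adj_ideal.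
by move=> ?; apply/ideal_add_gen_cons/ideal_add_gen_nil; [apply: adj_ideal|].
Qed.

Lemma ideal_add_gen2 I a b f : ideal I ->
  ideal_add_gen I [:: a; b] f <-> adj (adj I a) b f.
Proof.
move=> II; split.
  by move/ideal_add_gen_cons/ideal_add_gen1; apply; apply: adj_ideal.
by move=> ?; apply/ideal_add_gen_cons/ideal_add_gen1; [apply: adj_ideal|].
Qed.

Lemma ideal_pow_ideal I n : ideal I -> ideal (ideal_pow I n).
Proof.
move=> II; case: n => [|n] //=; split; last split.
- exists 0%N, (fun _ => 0), (fun _ => 0); split; [by case|split; first by case].
  by rewrite big_ord0.
- move=> f g [n1 [a1 [b1 [Ia1 [Ib1 ->]]]]] [n2 [a2 [b2 [Ia2 [Ib2 ->]]]]].
  exists (n1 + n2)%N.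
  exists (fun i => match split i with inl j => a1 j | inr j => a2 j end).
  exists (fun i => match split i with inl j => b1 j | inr j => b2 j end).
  split; [by move=> i; case: split|split; first by move=> i; case: split].
  rewrite big_split_ord /=; congr (_ + _); apply: eq_bigr => i _.
    by rewrite (unsplitK (inl i)).
  by rewrite (unsplitK (inr i)).
- move=> r f [n1 [a1 [b1 [Ia1 [Ib1 ->]]]]].
  exists n1, a1, (fun i => r * b1 i); split=> //; split.
    by move=> i; apply: idealMl.
  by rewrite mulr_sumr; apply: eq_bigr => i _; ring.
Qed.

Lemma ideal_powM I n f g : ideal_pow I n f -> I g -> ideal_pow I n.+1 (f * g).
Proof.
move=> If Ig; exists 1%N, (fun _ => f), (fun _ => g); do !split => //.
by rewrite big_ord1.
Qed.

Lemma ideal_pow_pw a b n f :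
  ideal_pow (gen_ideal [:: a; b]) n f <-> pw (@zid k) a b n f.
Proof.
have ZZ := @zid_ideal k.
have gi := gen_ideal_ideal [:: a; b].
split.
  elim: n f => [|n IH] f //= [l [u [v [pu [gv ->]]]]].
  apply: (ideal_sum (J := pw (@zid k) a b n.+1)) => [|i]; first exact: pw_ideal.
  have [d [e vde]] := (gen_ideal2 _ _ _).1 (gv i).
  have {}vde : v i = d * b + e * a.
    by apply/eqP; rewrite -subr_eq0 opprD addrA; apply/eqP.
  have pa := pw_mula ZZ (IH _ (pu i)); have pb := pw_mulb ZZ (IH _ (pu i)).
  apply: (ideal2 (r := e) (s := d) (pw_ideal a b n.+1 ZZ) pa pb).
  by rewrite vde; ring.
apply: pw_min => //; first exact: ideal_pow_ideal.
  by move=> g ->; case: (ideal_pow_ideal n gi).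
move=> i j <-; elim: j => [|j IH].
  rewrite addn0 expr0 mulr1; elim: i => [|i IH] //.
  by rewrite exprSr; apply: ideal_powM => //; apply: gen_ideal_mem; rewrite mem_head.
rewrite addnS exprSr mulrA; apply: ideal_powM => //; apply: gen_ideal_mem.
by rewrite !inE eqxx orbT.
Qed.

Lemma notin_closedField (s : seq k) : exists x, x \notin s.
Proof.
case: (altP (s =P [::])) => [->|s0]; first by exists 0.
(* This polynomial takes the value 1 on [s] and is not constant, so its roots lie outside [s]. *)
pose p : {poly k} := \prod_(a <- s) ('X - a%:P) + 1.
have [x] : exists x, root p x.
  apply/closed_rootP; rewrite /p size_polyDl size_prod_XsubC; last first.
    by rewrite size_polyC oner_neq0; case: (s) s0.
  by case: (s) s0.
rewrite /root /p hornerD horner_prod hornerC => px; exists x.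
apply/negP => xs; move: px; rewrite (big_rem x) //= !hornerE subrr mul0r add0r.
by rewrite oner_eq0.
Qed.

End Bridge.

Section AffineChart.
Variables (k : closedFieldType) (c : k).
Notation R := {mpoly k[4]}.
Notation zid := (@zid k).
Notation lx := (@lx k c).
Notation ly := (@ly k c).

(** The values of x0 / linf and y0 / minf at the point. *)
Definition chart (P : pt k) : k * k :=
  let: (a0, a1, b0, b1) := P in (a0 / (a1 - c * a0), b0 / (b1 - c * b0)).

Definition in_chart (P : pt k) : bool :=
  let: (a0, a1, b0, b1) := P in (a1 - c * a0 != 0) && (b1 - c * b0 != 0).

Definition fat_ideal (S : seq (k * k)) m (f : R) :=
  forall ab, ab \in S -> pw zid (lx ab.1) (ly ab.2) m f.

Lemma fat_ideal_ideal S m : ideal (fat_ideal S m).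
Proof.
have pI ab := pw_ideal (lx ab.1) (ly ab.2) m (@zid_ideal k).
split; [|split].
- by move=> ab _; case: (pI ab).
- by move=> f g fS gS ab abS; apply: idealD => //; [apply: fS|apply: gS].
- by move=> r f fS ab abS; apply: idealMl => //; apply: fS.
Qed.

Lemma pt_ideal_chart P m f : in_chart P ->
  ideal_pow (pt_ideal P) m f <-> pw zid (lx (chart P).1) (ly (chart P).2) m f.
Proof.
case: P => [[[a0 a1] b0] b1] /= /andP [ua ub].
(* In the chart the generators of the point ideal are nonzero scalar multiples of [lx] and [ly], so
   [pw_dvd] passes between the two ideals in both directions. *)
have scale (d0 d1 : k) (X0 X1 : R) : d1 - c * d0 != 0 ->
  X0 - (d0 / (d1 - c * d0))%:MP * (X1 - c%:MP * X0) =
  (d1 *: X0 - d0 *: X1) * (d1 - c * d0)^-1%:MP.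
  move=> ud; rewrite -[LHS]mulr1 -[1](mpolyC1 4 k) -(mulfV ud) !mpolyCM !mpolyCB.
  rewrite -!mul_mpolyC !mulrA; congr (_ * _).
  rewrite mulrBl [d0%:MP * _]mulrC -!mulrA -[X in _ * (_ * X)]mulrC.
  rewrite [_^-1%:MP * (_ * _)]mulrCA.
  have uV : (d1 - c * d0)^-1%:MP * (d1%:MP - c%:MP * d0%:MP) = 1 :> R.
    by rewrite -mpolyCM -mpolyCB -mpolyCM mulVf.
  move: uV; set w := _^-1%:MP => uV.
  transitivity (X0 * (d1%:MP - c%:MP * d0%:MP) -
    d0%:MP * (X1 - c%:MP * X0) * (w * (d1%:MP - c%:MP * d0%:MP))); first by ring.
  by rewrite uV; ring.
have scaleV (d0 d1 : k) (X0 X1 : R) : d1 - c * d0 != 0 ->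
  (d1 *: X0 - d0 *: X1) =
  (X0 - (d0 / (d1 - c * d0))%:MP * (X1 - c%:MP * X0)) * (d1 - c * d0)%:MP.
  by move=> ud; rewrite scale // -mulrA -mpolyCM mulVf // mulr1.
split.
  move/ideal_pow_pw; rewrite (scaleV a0 a1) // (scaleV b0 b1) //.
  by apply: pw_dvd; apply: zid_ideal.
move=> pf; apply/ideal_pow_pw; move: pf.
rewrite /lx /ly /linf /minf scale // scale //.
by apply: pw_dvd; apply: zid_ideal.
Qed.

Lemma fat_scheme_ideal_chart (Z : seq (pt k * nat)) m f :
  (forall p, p \in Z -> p.2 = m) -> (forall p, p \in Z -> in_chart p.1) ->
  fat_scheme_ideal Z f <-> fat_ideal [seq chart p.1 | p <- Z] m f.
Proof.
move=> Zm Zc; split=> [fZ _ /mapP [p pZ ->]|fS p pZ].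
  by apply/(pt_ideal_chart _ _ (Zc p pZ)); rewrite -(Zm p pZ); apply: fZ.
apply/(pt_ideal_chart _ _ (Zc p pZ)); rewrite (Zm p pZ); apply: fS.
by apply/mapP; exists p.
Qed.

Lemma supp_ideal_chart (Z : seq (pt k * nat)) f :
  (forall p, p \in Z -> in_chart p.1) ->
  supp_ideal Z f <-> fat_ideal [seq chart p.1 | p <- Z] 1 f.
Proof.
(* The support is the scheme with all multiplicities set to 1. *)
move=> Zc; pose Z1 := [seq (p.1, 1%N) | p <- Z].
have E : [seq chart p.1 | p <- Z] = [seq chart p.1 | p <- Z1].
  by rewrite -map_comp.
rewrite E; apply: iff_trans (fat_scheme_ideal_chart _ _ _); last 2 first.
- by move=> _ /mapP [p _ ->].
- by move=> _ /mapP [p pZ ->]; exact: (Zc p pZ).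
have pow1 P : pt_ideal P f <-> ideal_pow (pt_ideal P) 1 f.
  split=> [Pf|[n [a [b [_ [Pb ->]]]]]].
    by exists 1%N, (fun _ => 1), (fun _ => f); do !split => //; rewrite big_ord1 mul1r.
  have PP : ideal (pt_ideal P).
    by case: P Pb => [[[? ?] ?] ?] _; apply: gen_ideal_ideal.
  by apply: ideal_sum => // i; apply: idealMl => //; apply: Pb.
split=> [fZ _ /mapP [p pZ ->]|fZ p pZ]; first exact: (pow1 p.1).1 (fZ p pZ).
apply/(pow1 p.1); apply: (fZ (p.1, 1%N)); apply/mapP.
by exists p.
Qed.

End AffineChart.

Lemma exists_chart (k : closedFieldType) (Z : seq (pt k * nat)) :
  (forall p, p \in Z -> pt_valid p.1) ->
  exists c : k, forall p, p \in Z -> in_chart c p.1.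
Proof.
move=> Zv.
(* The values of [c] for which a form vanishes at the point. When a0 = 0 the quotient is the default
   0, a harmless exclusion: the form then takes the nonzero value a1 for every [c]. The same holds
   for b0. *)
pose bad (p : pt k * nat) := let: (a0, a1, b0, b1) := p.1 in [:: a1 / a0; b1 / b0].
have [c cZ] := notin_closedField (flatten [seq bad p | p <- Z]).
exists c => p pZ; have := Zv p pZ.
have : c \notin bad p by apply: contra cZ => cp; apply/flatten_mapP; exists p.
case: p {pZ} => [[[[a0 a1] b0] b1] m] /=; rewrite !inE negb_or => /andP [ca cb].
move=> [va vb].
have aux (d0 d1 : k) : c != d1 / d0 -> d0 != 0 \/ d1 != 0 -> d1 - c * d0 != 0.
  move=> cd vd; have [d00|d00] := eqVneq d0 0.
    by rewrite d00 mulr0 subr0; case: vd; rewrite ?d00 ?eqxx.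
  apply: contra cd => /eqP e; rewrite -(inj_eq (mulIf d00)) mulfVK //.
  by rewrite eq_sym -subr_eq0 e.
by rewrite !aux.
Qed.

(** * Complete intersections and grids *)

Section Bihomogeneous.
Variable k : closedFieldType.
Notation R := {mpoly k[4]}.
Implicit Types f g : R.

Lemma bihomogeneousD f g a b :
  bihomogeneous f a b -> bihomogeneous g a b -> bihomogeneous (f + g) a b.
Proof.
by move=> fab gab mo /msuppD_le; rewrite mem_cat => /orP [/fab|/gab].
Qed.

Lemma bihomogeneousM f g a b a' b' : bihomogeneous f a b ->
  bihomogeneous g a' b' -> bihomogeneous (f * g) (a + a') (b + b').
Proof.
move=> fab gab mo /msuppM_le /allpairsP [[m1 m2] /= [/fab [f1 f2] /gab [g1 g2] ->]].
by rewrite !mnmDE; lia.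
Qed.

Lemma bihomogeneousC (e : k) : bihomogeneous e%:MP 0 0.
Proof.
move=> mo; rewrite msuppC; case: eqP => // _; rewrite inE => /eqP ->.
by rewrite !mnm0E.
Qed.

Lemma bihomogeneousCM (e : k) f a b :
  bihomogeneous f a b -> bihomogeneous (e%:MP * f) a b.
Proof. by move=> fab; have := bihomogeneousM (@bihomogeneousC e) fab. Qed.

Lemma bihomogeneousN f a b : bihomogeneous f a b -> bihomogeneous (- f) a b.
Proof. by move=> fab mo; rewrite (perm_mem (msuppN f)) => /fab. Qed.

Lemma bihomogeneous_x0 : bihomogeneous (x0 k) 1 0.
Proof. by move=> mo; rewrite msuppX inE => /eqP ->; rewrite !mnm1E. Qed.

Lemma bihomogeneous_x1 : bihomogeneous (x1 k) 1 0.
Proof. by move=> mo; rewrite msuppX inE => /eqP ->; rewrite !mnm1E. Qed.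

Lemma bihomogeneous_y0 : bihomogeneous (y0 k) 0 1.
Proof. by move=> mo; rewrite msuppX inE => /eqP ->; rewrite !mnm1E. Qed.

Lemma bihomogeneous_y1 : bihomogeneous (y1 k) 0 1.
Proof. by move=> mo; rewrite msuppX inE => /eqP ->; rewrite !mnm1E. Qed.

Variable c : k.

Lemma bihomogeneous_linf : bihomogeneous (linf c) 1 0.
Proof.
apply: bihomogeneousD; first exact: bihomogeneous_x1.
by apply: bihomogeneousN; apply: bihomogeneousCM; exact: bihomogeneous_x0.
Qed.

Lemma bihomogeneous_minf : bihomogeneous (minf c) 0 1.
Proof.
apply: bihomogeneousD; first exact: bihomogeneous_y1.
by apply: bihomogeneousN; apply: bihomogeneousCM; exact: bihomogeneous_y0.
Qed.

Lemma bihomogeneous_lx a : bihomogeneous (lx c a) 1 0.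
Proof.
apply: bihomogeneousD; first exact: bihomogeneous_x0.
by apply: bihomogeneousN; apply: bihomogeneousCM; exact: bihomogeneous_linf.
Qed.

Lemma bihomogeneous_ly b : bihomogeneous (ly c b) 0 1.
Proof.
apply: bihomogeneousD; first exact: bihomogeneous_y0.
by apply: bihomogeneousN; apply: bihomogeneousCM; exact: bihomogeneous_minf.
Qed.

Lemma bihomogeneous_Fx s : bihomogeneous (Fx c s) (size s) 0.
Proof.
rewrite /Fx; elim: s => [|a s IH]; first by rewrite big_nil; apply: (@bihomogeneousC 1).
by rewrite big_cons; have := bihomogeneousM (@bihomogeneous_lx a) IH.
Qed.

Lemma bihomogeneous_Gy s : bihomogeneous (Gy c s) 0 (size s).
Proof.
rewrite /Gy; elim: s => [|a s IH]; first by rewrite big_nil; apply: (@bihomogeneousC 1).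
by rewrite big_cons; have := bihomogeneousM (@bihomogeneous_ly a) IH.
Qed.

Lemma subst_bihomogeneous_x (p l q m q' m' : k) f a : bihomogeneous f a 0 ->
  subst c idfun p l q m f = subst c idfun p l q' m' f.
Proof.
move=> fa; apply: eq_big_seq => mo /fa [_ /eqP]; rewrite addn_eq0 => /andP [/eqP m2 /eqP m3].
congr (_ * _); rewrite /mmap1 !big_ord_recr !big_ord0 /=.
rewrite (_ : (widen_ord (leqnSn 3) ord_max) = i2) ?m2; last exact: val_inj.
rewrite (_ : ord_max = i3) ?m3; last exact: val_inj.
by [].
Qed.

Lemma subst_bihomogeneous_y (p l q m p' l' : k) f b : bihomogeneous f 0 b ->
  subst c idfun p l q m f = subst c idfun p' l' q m f.
Proof.
move=> fa; apply: eq_big_seq => mo /fa [/eqP + _]; rewrite addn_eq0 => /andP [/eqP m0 /eqP m1].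
congr (_ * _); rewrite /mmap1 !big_ord_recl !big_ord0 /=.
rewrite (_ : lift ord0 ord0 = i1) ?m1; last exact: val_inj.
rewrite (_ : ord0 = i0) ?m0; last exact: val_inj.
by [].
Qed.

End Bihomogeneous.

Section Grid.
Variables (k : closedFieldType) (c : k) (S : seq (k * k)).
Notation R := {mpoly k[4]}.
Notation zid := (@zid k).
Notation lx := (@lx k c).
Notation ly := (@ly k c).
Notation evk a b := (subst c (@idfun k) a 1 b 1).

Definition rows := undup [seq ab.1 | ab <- S].
Definition cols := undup [seq ab.2 | ab <- S].
Definition is_grid := forall a b, a \in rows -> b \in cols -> (a, b) \in S.

Lemma rowsP a : reflect (exists b, (a, b) \in S) (a \in rows).
Proof.
rewrite mem_undup; apply: (iffP mapP) => [[[a' b] abS ->]|[b abS]]; first by exists b.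
by exists (a, b).
Qed.

Lemma colsP b : reflect (exists a, (a, b) \in S) (b \in cols).
Proof.
rewrite mem_undup; apply: (iffP mapP) => [[[a b'] abS ->]|[a abS]]; first by exists a.
by exists (a, b).
Qed.

Lemma fat_ideal_grid m f : is_grid ->
  fat_ideal c S m f <-> pw zid (Fx c rows) (Gy c cols) m f.
Proof.
move=> gS; split=> [fS|pf [a b] abS /=].
  by apply: pw_grid; rewrite ?undup_uniq // => a b aA bB; apply: (fS (a, b)); apply: gS.
have aA : a \in rows by apply/rowsP; exists b.
have bB : b \in cols by apply/colsP; exists a.
move: pf; rewrite /Fx /Gy (big_rem a aA) (big_rem b bB) /=.
by apply: pw_dvd; apply: zid_ideal.
Qed.

Lemma pw1_adj a b f : pw zid a b 1 f <-> adj (adj zid a) b f.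
Proof.
rewrite /=; split=> [[g [d [_ fd]]]|[d [e fd]]].
  by exists d, g; rewrite /zid -[RHS]fd expr1; ring.
by exists e, d; split=> //; rewrite /zid -[RHS]fd expr1; ring.
Qed.

Lemma CI_of_grid : is_grid -> complete_intersection (fat_ideal c S 1).
Proof.
move=> gS; exists (size rows), (size cols), (Fx c rows), (Gy c cols).
split; first exact: bihomogeneous_Fx.
split; first exact: bihomogeneous_Gy.
move=> f; split.
  by move/(fat_ideal_grid _ _ gS)/pw1_adj => ?; apply/gen_ideal2.
by move/gen_ideal2 => ?; apply/(fat_ideal_grid _ _ gS)/pw1_adj.
Qed.

Lemma fat_ideal1_eval a b f : fat_ideal c S 1 f -> (a, b) \in S -> evk a b f = 0.
Proof.
move=> fS abS; have /pw1_adj := fS _ abS.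
apply: adj_ker; last by rewrite /= subst_ly /= mulr1 subrr.
by apply: adj_ker; [apply: zid_ker|rewrite /= subst_lx /= mulr1 subrr].
Qed.

(** F involves only the x's and vanishes on row [a], G involves only the y's and vanishes on column
    [b]; so every element of the ideal vanishes at (a, b). *)
Lemma grid_of_CI : complete_intersection (fat_ideal c S 1) -> is_grid.
Proof.
move=> [a' [b' [F [G [Fa [Gb FG]]]]]] a b aA bB; apply/negPn/negP => nabS.
(* A form that vanishes on S but not at (a, b): points of other rows are killed by an x-form, points
   of row [a] by a y-form. *)
pose h := \prod_(ab <- S) (if ab.1 != a then lx ab.1 else ly ab.2).
have hS : fat_ideal c S 1 h.
  move=> ab abS; apply/pw1_adj; rewrite /h (big_rem ab) //= mulrC.
  apply: idealMl; first by do 2!apply: adj_ideal; apply: zid_ideal.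
  case: ifP => _; last by apply: adj_gen; apply: adj_ideal; apply: zid_ideal.
  by apply: adj_sub; [apply: adj_ideal; apply: zid_ideal|apply: adj_gen; apply: zid_ideal].
have F0 : evk a b F = 0.
  have [b1 ab1] := rowsP _ aA; rewrite (subst_bihomogeneous_x _ _ _ _ _ b1 1 Fa).
  by apply: fat_ideal1_eval => //; apply/FG; apply: gen_ideal_mem; rewrite mem_head.
have G0 : evk a b G = 0.
  have [a1 ab1] := colsP _ bB; rewrite (subst_bihomogeneous_y _ _ _ _ _ a1 1 Gb).
  by apply: fat_ideal1_eval => //; apply/FG; apply: gen_ideal_mem; rewrite !inE eqxx orbT.
have : evk a b h = 0.
  move/FG/gen_ideal2: hS; apply: adj_ker => //.
  by apply: adj_ker => //; apply: zid_ker.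
apply/eqP; rewrite rmorph_prod /= prodf_seq_neq0; apply/allP => ab abS /=.
case: ifPn => [na|]; first by rewrite subst_lx /= mulr1 subr_eq0 eq_sym.
rewrite negbK => /eqP ea; rewrite subst_ly /= mulr1 subr_eq0.
by apply: contra nabS => /eqP ->; rewrite -ea -surjective_pairing.
Qed.

End Grid.

(** * Dimension and depth *)

Section Primes.
Variable A : comNzRingType.
Implicit Types (P : A -> Prop) (f g : A).

Definition prime_id P := ideal P /\ ~ P 1 /\ (forall f g, P (f * g) -> P f \/ P g).

Lemma prime_exp P f n : prime_id P -> P (f ^+ n) -> P f.
Proof.
move=> [_ [P1 PM]]; elim: n => [|n IH]; first by rewrite expr0.
by rewrite exprS => /PM [].
Qed.

Lemma prime_prod (I : eqType) (s : seq I) (F : I -> A) P :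
  prime_id P -> P (\prod_(i <- s) F i) -> exists2 i, i \in s & P (F i).
Proof.
move=> [_ [P1 PM]]; elim: s => [|i s IH]; first by rewrite big_nil.
rewrite big_cons => /PM [Pi|/IH [j js Pj]]; first by exists i; rewrite ?mem_head.
by exists j => //; rewrite inE js orbT.
Qed.

End Primes.

Lemma prime_preim (A B : comNzRingType) (phi : {rmorphism B -> A}) (P : A -> Prop) :
  prime_id P -> prime_id (fun f : B => P (phi f)).
Proof.
move=> [[P0 [PD PM]] [P1 PP]]; split; last split.
- split; [by rewrite rmorph0|split=> [f g|r f]].
    by rewrite rmorphD; apply: PD.
  by rewrite rmorphM; apply: PM.
- by rewrite rmorph1.
- by move=> f g; rewrite rmorphM => /PP.
Qed.

Lemma prime_ker (A : comNzRingType) (D : idomainType) (phi : {rmorphism A -> D}) :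
  prime_id (fun f => phi f = 0).
Proof.
split; last split.
- split; [exact: rmorph0|split=> [f g|r f]].
    by rewrite rmorphD => -> ->; rewrite addr0.
  by rewrite rmorphM => ->; rewrite mulr0.
- by rewrite rmorph1; apply/eqP; rewrite oner_neq0.
- by move=> f g; rewrite rmorphM => /eqP; rewrite mulf_eq0 => /orP [] /eqP; [left|right].
Qed.

(** * Prime chains in a polynomial ring in one variable over a domain *)

Section PolyPrimes.
Variable D : idomainType.
Implicit Types (P : {poly D} -> Prop) (f g h r : {poly D}).

Definition min_elt P r :=
  [/\ P r, r != 0 & forall g, P g -> g != 0 -> (size r <= size g)%N].

Lemma min_elt_exists P f : P f -> f != 0 -> exists r, min_elt P r.
Proof.
move: {2}(size f) (leqnn (size f)) => n; elim: n f => [|n IH] f.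
  by rewrite leqn0 size_poly_eq0 => ->.
move=> fn Pf f0.
have [[g [Pg [g0 lt]]]|none] :=
  classic (exists g, P g /\ g != 0 /\ (size g < size f)%N).
  by apply: (IH g) => //; rewrite -ltnS (leq_trans lt).
exists f; split=> // g Pg g0; rewrite leqNgt; apply/negP => lt.
by apply: none; exists g.
Qed.

(** Pseudo-division by [r] leaves a remainder in [P] of smaller degree, which must vanish; the power
    of the leading coefficient clears denominators. *)
Lemma min_elt_div P r h : ideal P -> min_elt P r -> P h ->
  exists e q, (lead_coef r ^+ e)%:P * h = q * r.
Proof.
move=> PP [Pr r0 rmin] Ph; have := Pdiv.Idomain.divp_eq h r.
rewrite -mul_polyC => E; exists (scalp h r), (h %/ r); rewrite E.
suff -> : h %% r = 0 by rewrite addr0.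
apply/eqP/negPn/negP => m0; have : P (h %% r).
  apply: (ideal2 (r := (lead_coef r ^+ scalp h r)%:P) (s := - (h %/ r)) PP Ph Pr).
  by rewrite E; ring.
by move/rmin/(_ m0); rewrite leqNgt Pdiv.Idomain.ltn_modpN0.
Qed.

(* Otherwise, over the fraction field of D, P and Q would both be generated by an
   irreducible polynomial, namely an element of least degree. *)
Lemma prime_chain_const P Q f g : prime_id P -> prime_id Q ->
  (forall h, P h -> Q h) -> P f -> f != 0 -> Q g -> ~ P g ->
  exists2 d, d != 0 & Q d%:P.
Proof.
move=> pP pQ PQ Pf f0 Qg nPg.
have [[d [d0 Qd]]|noc] := classic (exists d, d != 0 /\ Q d%:P); first by exists d.
have [PI [P1 PM]] := pP; have [QI [Q1 QM]] := pQ.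
have [r rmin] := min_elt_exists (PQ _ Pf) f0.
have [p pmin] := min_elt_exists Pf f0.
have [Qr r0 rle] := rmin; have [Pp p0 ple] := pmin.
have lr0 e : lead_coef r ^+ e != 0 by rewrite expf_neq0 // lead_coef_eq0.
have nPr : ~ P r.
  move=> Pr; have [e [q E]] := min_elt_div QI rmin Qg.
  have : P ((lead_coef r ^+ e)%:P * g) by rewrite E; apply: idealMl.
  by case/PM=> // /PQ ?; apply: noc; exists (lead_coef r ^+ e).
have [e [q E]] := min_elt_div QI rmin (PQ _ Pp).
have : P (q * r) by rewrite -E; apply: idealMl.
case/PM=> // Pq; have q0 : q != 0.
  apply: contraTneq p0 => q0; move/eqP: E; rewrite q0 mul0r mulf_eq0.
  by rewrite polyC_eq0 (negPf (lr0 e)) /= => ->.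
(* The product q r has the degree of [p] while [q] has at least that degree, so [r] is a nonzero
   constant, contrary to [noc]. *)
have := ple _ Pq q0; have : size (q * r) = size p.
  by rewrite -E mul_polyC size_scale.
rewrite size_mul // => sz le.
have r1 : (size r <= 1)%N.
  have : (0 < size q)%N by rewrite size_poly_gt0.
  by lia.
case: noc; exists (r`_0); rewrite -size1_polyC //; split=> //.
by apply: contra r0 => /eqP e0; rewrite (size1_polyC r1) e0.
Qed.

End PolyPrimes.

(** * Dimension two and depth two *)

Section GridCM.
Variables (k : closedFieldType) (c : k).
Notation R := {mpoly k[4]}.
Notation zid := (@zid k).
Notation lx := (@lx k c).
Notation ly := (@ly k c).
Notation linf := (@linf k c).
Notation minf := (@minf k c).
Notation endo := (subst c (@mpolyC 4 k)).
Notation ev0 := (subst c (@idfun k) 0 0 0 0).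

(* the k-algebra morphism k[u][v] -> R with u, v |-> s, t *)
Definition ev2 (s t : R) : {poly {poly k}} -> R :=
  horner_eval t \o map_poly (horner_alg s).

HB.instance Definition _ s t := GRing.RMorphism.on (ev2 s t).

Lemma ev2C s t (p : {poly k}) : ev2 s t p%:P = horner_alg s p.
Proof. by rewrite /ev2 /= map_polyC /= /horner_eval hornerC. Qed.

Lemma ev2_const s t (a : k) : ev2 s t a%:P%:P = a%:MP.
Proof. by rewrite ev2C horner_algC alg_mpolyC. Qed.

Lemma ev2_u s t : ev2 s t 'X%:P = s.
Proof. by rewrite ev2C horner_algX. Qed.

Lemma ev2_v s t : ev2 s t 'X = t.
Proof. by rewrite /ev2 /= map_polyX /horner_eval hornerX. Qed.

(** R/P0 is a quotient of k[u][v], so the chain pulls back there and [prime_chain_const] puts a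
    nonzero polynomial in u alone into P2. It splits into linear factors over k, one of which lies
    in P2. *)
Lemma prime_linear_factor (P0 P1 P2 : R -> Prop) s t f g :
  prime_id P0 -> prime_id P1 -> prime_id P2 ->
  (forall h, P0 h -> P1 h) -> (forall h, P1 h -> P2 h) ->
  (forall h, exists p, P0 (h - ev2 s t p)) ->
  P1 f -> ~ P0 f -> P2 g -> ~ P1 g -> exists e : k, P2 (s - e%:MP).
Proof.
move=> pP0 pP1 pP2 P01 P12 gen P1f nP0f P2g nP1g.
have [[I0 _] [I1 _] [I2 [P21 P2M]]] := And3 pP0 pP1 pP2.
have [p Pp] := gen f; have [q Pq] := gen g.
have P1p : P1 (ev2 s t p).
  by apply: (ideal2 (r := 1) (s := -1) I1 P1f (P01 _ Pp)); ring.
have p0 : p != 0.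
  apply: contra_notN nP0f => /eqP p0; move: Pp; rewrite p0 rmorph0 subr0 //.
have P2q : P2 (ev2 s t q).
  by apply: (ideal2 (r := 1) (s := -1) I2 P2g (P12 _ (P01 _ Pq))); ring.
have nP1q : ~ P1 (ev2 s t q).
  move=> P1q; apply: nP1g.
  by apply: (ideal2 (r := 1) (s := 1) I1 P1q (P01 _ Pq)); ring.
have [d d0 P2d] := prime_chain_const (prime_preim (ev2 s t) pP1)
  (prime_preim (ev2 s t) pP2) (fun h => P12 (ev2 s t h)) P1p p0 P2q nP1q.
have {P2d} : P2 (ev2 s t d%:P) := P2d.
have [rs {1}->] := closed_field_poly_normal d.
rewrite ev2C linearZ /= -mul_mpolyC => /P2M [Pl|].
  case: P21; apply: (ideal1 (r := (lead_coef d)^-1%:MP) I2 Pl).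
  by rewrite mulr1 -mpolyCM mulVf ?mpolyC1 // lead_coef_eq0.
rewrite rmorph_prod => /(prime_prod pP2) [e _ Pe]; exists e.
by move: Pe; rewrite rmorphB /= horner_algX horner_algC alg_mpolyC.
Qed.

(** Modulo a prime over [I], [x0] and [y0] are multiples of [linf] and [minf], so R/P0 is generated
    by two elements. After two strict steps both become constants, R/P2 is k, and no larger proper
    prime remains. *)
Lemma krull_dim_lt3 (I : R -> Prop) :
  (forall P, prime_id P -> (forall f, I f -> P f) ->
    exists a b, P (lx a) /\ P (ly b)) ->
  ~ krull_dim_ge I 3.
Proof.
move=> IP [P [Pprime [IP0 Pchain]]].
have p0 := Pprime 0%N isT; have p1 := Pprime 1%N isT.
have p2 := Pprime 2%N isT; have p3 := Pprime 3%N isT.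
have [P01 [f [P1f nP0f]]] := Pchain 0%N isT.
have [P12 [g [P2g nP1g]]] := Pchain 1%N isT.
have [P23 [h [P3h nP2h]]] := Pchain 2%N isT.
have [a [b [Pa Pb]]] := IP _ p0 IP0.
have I0 : ideal (P 0%N) by case: p0.
have I2 : ideal (P 2%N) by case: p2.
have I3 : ideal (P 3%N) by case: p3.
have gen s t : (exists p, ev2 s t p = linf) -> (exists p, ev2 s t p = minf) ->
    forall u, exists p, P 0%N (u - ev2 s t p).
  move=> [pl El] [pm Em]; elim/(@mpoly4_ind k c) => [e|u v [p Pp] [q Pq]|u v [p Pp] [q Pq]||||].
  - by exists e%:P%:P; rewrite ev2_const subrr; case: I0.
  - exists (p + q); rewrite rmorphD.
    by apply: (ideal2 (r := 1) (s := 1) I0 Pp Pq); ring.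
  - exists (p * q); rewrite rmorphM.
    by apply: (ideal2 (r := v) (s := ev2 s t p) I0 Pp Pq); ring.
  - by exists (a%:P%:P * pl); rewrite rmorphM /= ev2_const El.
  - by exists pl; rewrite El subrr; case: I0.
  - by exists (b%:P%:P * pm); rewrite rmorphM /= ev2_const Em.
  - by exists pm; rewrite Em subrr; case: I0.
have [|e1 Pe1] := prime_linear_factor (s := linf) (t := minf) p0 p1 p2 P01 P12 _ P1f nP0f P2g nP1g.
  by apply: gen; [exists 'X%:P; apply: ev2_u|exists 'X; apply: ev2_v].
have [|e2 Pe2] := prime_linear_factor (s := minf) (t := linf) p0 p1 p2 P01 P12 _ P1f nP0f P2g nP1g.
  by apply: gen; [exists 'X; apply: ev2_v|exists 'X%:P; apply: ev2_u].
have cst u : exists e : k, P 2%N (u - e%:MP).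
  elim/(@mpoly4_ind k c): u => [e|u v [d Pd] [e Pe]|u v [d Pd] [e Pe]||||].
  - by exists e; rewrite subrr; case: I2.
  - exists (d + e); rewrite mpolyCD.
    by apply: (ideal2 (r := 1) (s := 1) I2 Pd Pe); ring.
  - exists (d * e); rewrite mpolyCM.
    by apply: (ideal2 (r := v) (s := d%:MP) I2 Pd Pe); ring.
  - exists (a * e1); rewrite mpolyCM.
    apply: (ideal2 (r := 1) (s := a%:MP) I2 (P12 _ (P01 _ Pa)) Pe1).
    by rewrite /lx; ring.
  - by exists e1.
  - exists (b * e2); rewrite mpolyCM.
    apply: (ideal2 (r := 1) (s := b%:MP) I2 (P12 _ (P01 _ Pb)) Pe2).
    by rewrite /ly; ring.
  - by exists e2.
have [e Pe] := cst h.
have e0 : e != 0.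
  by apply: contra_notN nP2h => /eqP e0; move: Pe; rewrite e0 mpolyC0 subr0.
case: p3 => _ [P31 _]; apply: P31.
have eV : e^-1%:MP * e%:MP = 1 :> R by rewrite -mpolyCM mulVf // mpolyC1.
apply: (ideal2 (r := e^-1%:MP) (s := - e^-1%:MP) I3 P3h (P23 _ Pe)).
by rewrite -eV; ring.
Qed.

Lemma fat_ideal_eval0 S m f : S != [::] -> (0 < m)%N -> fat_ideal c S m f -> ev0 f = 0.
Proof.
case: S => // ab S _ m0 /(_ ab (mem_head _ _)) /(pw_leq (zid_ideal _) m0) /pw1_adj.
apply: adj_ker; last by rewrite /= subst_ly mulr0 subrr.
by apply: adj_ker; [apply: zid_ker|rewrite /= subst_lx mulr0 subrr].
Qed.

Lemma krull_dim_ge2 S m : S != [::] -> (0 < m)%N -> krull_dim_ge (fat_ideal c S m) 2.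
Proof.
case: S => // [[a b] S] _ m0.
(* The chain of kernels corresponds to a plane, a line in it and the origin of affine 4-space. *)
pose th0 := endo (a%:MP * linf) linf (b%:MP * minf) minf.
pose th1 := endo (a%:MP * linf) linf 0 0.
exists (fun i f => match i with 0 => th0 f = 0 | 1 => th1 f = 0 | _ => ev0 f = 0 end).
split; last split.
- by case=> [|[|i]] _; apply: prime_ker.
- move=> f /(_ (a, b) (mem_head _ _)) /(pw_leq (zid_ideal _) m0) /pw1_adj.
  apply: adj_ker; last by rewrite /= subst_ly subrr.
  by apply: adj_ker; [apply: zid_ker|rewrite /= subst_lx subrr].
case=> [|[|//]] _; split.
- move=> f f0; have : adj (adj zid (lx a)) (ly b) f.
    have JJ := adj_ideal (ly b) (adj_ideal (lx a) (@zid_ideal k)).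
    have := endo_congr (c := c) f JJ (p := a%:MP * linf) (l := linf) (q := b%:MP * minf) (m := minf).
    rewrite [X in f - X]f0 [f - 0]subr0; apply; try exact: ideal_subrr.
      by apply: adj_sub; [apply: adj_ideal; apply: zid_ideal|apply: adj_gen; apply: zid_ideal].
    by apply: adj_gen; apply: adj_ideal; apply: zid_ideal.
  apply: adj_ker; last by rewrite /= subst_ly mulr0 subrr.
  by apply: adj_ker; [apply: zid_ker|rewrite /= subst_lx subrr].
- exists minf; rewrite /th0 /th1 !subst_minf; split=> //.
  by apply/eqP; apply: minf_neq0.
- move=> f f0; have : adj (adj (adj zid (lx a)) (y0 k)) minf f.
    have ZJ := adj_ideal (lx a) (@zid_ideal k); have YJ := adj_ideal (y0 k) ZJ.
    have JJ := adj_ideal minf YJ.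
    have := endo_congr (c := c) f JJ (p := a%:MP * linf) (l := linf) (q := 0) (m := 0).
    rewrite [X in f - X]f0 [f - 0]subr0; apply; rewrite ?subr0; first last.
    + exact: adj_gen.
    + by apply: adj_sub => //; apply: adj_gen.
    + exact: ideal_subrr.
    + by do 2!apply: adj_sub => //; apply: adj_gen; apply: zid_ideal.
  apply: adj_ker; last by rewrite /= subst_minf.
  apply: adj_ker; last by rewrite /= substy0.
  by apply: adj_ker; [apply: zid_ker|rewrite /= subst_lx mulr0 subrr].
- exists linf; rewrite /th1 !subst_linf; split=> //.
  by apply/eqP; apply: linf_neq0.
Qed.

Lemma krull_dim_ge_leq (I : R -> Prop) n n' :
  (n' <= n)%N -> krull_dim_ge I n -> krull_dim_ge I n'.
Proof.
move=> le [P [Pp [IP Pc]]]; exists P; split; last split=> //.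
  by move=> i ile; apply: Pp; apply: leq_trans le.
by move=> i ile; apply: Pc; apply: leq_trans le.
Qed.

Lemma depth_ge_leq (I : R -> Prop) n n' : (n' <= n)%N -> depth_ge I n -> depth_ge I n'.
Proof.
move=> le [fs [sz [fi [fr f1]]]]; exists (take n' fs); split.
  by rewrite size_takel // sz.
split; first by move=> f /mem_take; apply: fi.
split.
  move=> i; rewrite size_takel ?sz // => ilt; rewrite nth_take // take_takel; last exact: ltnW.
  by apply: fr; rewrite sz; apply: leq_trans le.
move=> [g [d [Ig [E gd]]]]; apply: f1; exists g, d; do 2!split=> //.
apply: gen_ideal_min gd; first exact: gen_ideal_ideal.
by move=> u /mem_take uf; apply: gen_ideal_mem.
Qed.

Lemma irrelevant_linf : irrelevant_ideal linf.
Proof.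
have II := gen_ideal_ideal [:: x0 k; x1 k; y0 k; y1 k].
have Ix0 : irrelevant_ideal (x0 k) by apply: gen_ideal_mem; rewrite !inE eqxx.
have Ix1 : irrelevant_ideal (x1 k) by apply: gen_ideal_mem; rewrite !inE eqxx !orbT.
apply: (ideal2 (r := 1) (s := - c%:MP) II Ix1 Ix0).
by rewrite /linf; ring.
Qed.

Lemma irrelevant_minf : irrelevant_ideal minf.
Proof.
have II := gen_ideal_ideal [:: x0 k; x1 k; y0 k; y1 k].
have Iy0 : irrelevant_ideal (y0 k) by apply: gen_ideal_mem; rewrite !inE eqxx !orbT.
have Iy1 : irrelevant_ideal (y1 k) by apply: gen_ideal_mem; rewrite !inE eqxx !orbT.
apply: (ideal2 (r := 1) (s := - c%:MP) II Iy1 Iy0).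
by rewrite /minf; ring.
Qed.

Lemma irrelevant_min (J : R -> Prop) f : ideal J ->
  J (x0 k) -> J linf -> J (y0 k) -> J minf -> irrelevant_ideal f -> J f.
Proof.
move=> JJ Jx0 JL Jy0 JM; apply: gen_ideal_min => // g.
rewrite !inE => /or4P [] /eqP -> //.
  by apply: (ideal2 (r := 1) (s := c%:MP) JJ JL Jx0); rewrite /linf; ring.
by apply: (ideal2 (r := 1) (s := c%:MP) JJ JM Jy0); rewrite /minf; ring.
Qed.

(** Each [lx a] restricts to [x0] on [linf = 0]; with the analogue for y this makes [x0] and [y0]
    nilpotent modulo I + (linf, minf). *)
Lemma Fx_mod_linf s : adj zid linf (Fx c s - x0 k ^+ size s).
Proof.
rewrite /Fx; elim: s => [|a s IH].
  by rewrite big_nil expr0 subrr; case: (adj_ideal linf (@zid_ideal k)).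
have Ja : adj zid linf (lx a - x0 k).
  by exists (- a%:MP); rewrite /zid /lx; ring.
rewrite big_cons /= exprS.
apply: (ideal2 (r := \prod_(j <- s) lx j) (s := x0 k) (adj_ideal linf (@zid_ideal k)) Ja IH).
ring.
Qed.

Lemma Gy_mod_minf t : adj zid minf (Gy c t - y0 k ^+ size t).
Proof.
rewrite /Gy; elim: t => [|b t IH].
  by rewrite big_nil expr0 subrr; case: (adj_ideal minf (@zid_ideal k)).
have Jb : adj zid minf (ly b - y0 k).
  by exists (- b%:MP); rewrite /zid /ly; ring.
rewrite big_cons /= exprS.
apply: (ideal2 (r := \prod_(j <- t) ly j) (s := y0 k) (adj_ideal minf (@zid_ideal k)) Jb IH).
ring.
Qed.

Lemma FxX_mod_linf s m : adj zid linf (Fx c s ^+ m - x0 k ^+ (size s * m)).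
Proof.
have JJ := adj_ideal linf (@zid_ideal k).
elim: m => [|m IH]; first by rewrite muln0 !expr0 subrr; case: JJ.
rewrite mulnS exprD exprS.
apply: (ideal2 (r := Fx c s ^+ m) (s := x0 k ^+ size s) JJ (Fx_mod_linf s) IH).
ring.
Qed.

Lemma GyX_mod_minf t m : adj zid minf (Gy c t ^+ m - y0 k ^+ (size t * m)).
Proof.
have JJ := adj_ideal minf (@zid_ideal k).
elim: m => [|m IH]; first by rewrite muln0 !expr0 subrr; case: JJ.
rewrite mulnS exprD exprS.
apply: (ideal2 (r := Gy c t ^+ m) (s := y0 k ^+ size t) JJ (Gy_mod_minf t) IH).
ring.
Qed.

Section Scheme.
Variables (S : seq (k * k)) (m : nat).
Hypotheses (S0 : S != [::]) (m0 : (0 < m)%N).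
Notation I := (fat_ideal c S m).
Notation Q := (adj (adj I linf) minf).

Let II : ideal I := fat_ideal_ideal c S m.
Let QI : ideal Q := adj_ideal minf (adj_ideal linf II).

Lemma FxX_fat_ideal : I (Fx c (rows S) ^+ m).
Proof.
move=> [a b] abS /=.
have aA : a \in rows S by apply/rowsP; exists b.
rewrite /Fx (big_rem a aA) /= exprMn.
have := pw_mulX (lx a) (ly b) m 0 ((\prod_(y <- rem a (rows S)) lx y) ^+ m) (@zid_ideal k).
by rewrite addn0 expr0 mulr1.
Qed.

Lemma GyX_fat_ideal : I (Gy c (cols S) ^+ m).
Proof.
move=> [a b] abS /=.
have bB : b \in cols S by apply/colsP; exists a.
rewrite /Gy (big_rem b bB) /= exprMn.
have := pw_mulX (lx a) (ly b) 0 m ((\prod_(y <- rem b (cols S)) ly y) ^+ m) (@zid_ideal k).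
by rewrite add0n expr0 mul1r.
Qed.

Lemma x0X_mem : Q (x0 k ^+ (size (rows S) * m)).
Proof.
apply: adj_sub; first exact: adj_ideal.
have [d Ed] := FxX_mod_linf (rows S) m; exists (- d).
have := FxX_fat_ideal; congr (I _); apply/eqP; rewrite -subr_eq0; apply/eqP.
by rewrite -[RHS]Ed; ring.
Qed.

Lemma y0X_mem : Q (y0 k ^+ (size (cols S) * m)).
Proof.
have [d Ed] := GyX_mod_minf (cols S) m; exists (- d); apply: adj_sub => //.
have := GyX_fat_ideal; congr (I _); apply/eqP; rewrite -subr_eq0; apply/eqP.
by rewrite -[RHS]Ed; ring.
Qed.

Lemma linf_mem : Q linf.
Proof. by apply: adj_sub; [exact: adj_ideal|exact: adj_gen]. Qed.

Lemma minf_mem : Q minf.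
Proof. by apply: adj_gen; exact: adj_ideal. Qed.

Lemma one_notin : ~ Q 1.
Proof.
move=> Q1; have : ev0 1 = 0.
  move: Q1; apply: adj_ker; last by rewrite /= subst_minf.
  apply: adj_ker; last by rewrite /= subst_linf.
  by move=> f; apply: fat_ideal_eval0.
by rewrite rmorph1; apply/eqP; rewrite oner_neq0.
Qed.

Lemma irrelevant_nilpotent f : irrelevant_ideal f -> exists n, Q (f ^+ n).
Proof.
apply: (@irrelevant_min (fun f => exists n, Q (f ^+ n))).
- split; [by exists 1%N; rewrite expr1; case: QI|split=> [u v [n Qu] [n' Qv]|r u [n Qu]]].
    by exists (n + n')%N; apply: radicalD.
  by exists n; rewrite exprMn; apply: idealMl.
- by eexists; exact: x0X_mem.
- by exists 1%N; rewrite expr1; exact: linf_mem.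
- by eexists; exact: y0X_mem.
- by exists 1%N; rewrite expr1; exact: minf_mem.
Qed.

(** With a regular sequence of length 3, [depth_le2] puts [s] into Q as soon as x0 s and y0 s lie
    there. Starting from high powers this descends to 1, which is not in Q. *)
Lemma depth_ge3_false : nzd I linf -> nzd (adj I linf) minf -> ~ depth_ge I 3.
Proof.
move=> IL IM [fs [sz [fi [fr _]]]].
case: fs sz fi fr => [|f1 [|f2 [|f3 [|? ?]]]] // _ fi fr.
have r1 : nzd I f1.
  apply: nzd_ext (fr 0%N isT) => g; exact: ideal_add_gen_nil.
have r2 : nzd (adj I f1) f2.
  apply: nzd_ext (fr 1%N isT) => g; exact: ideal_add_gen1.
have r3 : nzd (adj (adj I f1) f2) f3.
  apply: nzd_ext (fr 2%N isT) => g; exact: ideal_add_gen2.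
have step s : Q (x0 k * s) -> Q (y0 k * s) -> Q s.
  move=> Qx Qy; have fs f : irrelevant_ideal f -> Q (f * s).
    apply: (@irrelevant_min (fun f => Q (f * s))) => //.
    - split; [by rewrite mul0r; case: QI|split=> [u v Qu Qv|r u Qu]].
        by rewrite mulrDl; apply: idealD.
      by rewrite -mulrA; apply: idealMl.
    - by rewrite mulrC; apply: idealMl => //; exact: linf_mem.
    - by rewrite mulrC; apply: idealMl => //; exact: minf_mem.
  by apply: (depth_le2 II IL IM r1 r2 r3); apply: fs; apply: fi; rewrite !inE eqxx ?orbT.
pose N := (size (rows S) * m + size (cols S) * m)%N.
(* Here [n] measures how far i + j is below N; at N one exponent reaches its nilpotency bound. *)
have mono n i j : (i + j + n)%N = N -> Q (x0 k ^+ i * y0 k ^+ j).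
  elim: n i j => [|n IH] i j ijn; last first.
    by apply: step; [rewrite mulrA -exprS|rewrite mulrCA -exprS]; apply: IH; lia.
  have [le|lt] := leqP (size (rows S) * m) i.
    by rewrite mulrC -(subnK le) exprD mulrA; apply: idealMl => //; exact: x0X_mem.
  have le : (size (cols S) * m <= j)%N by rewrite /N in ijn; lia.
  by rewrite -(subnK le) exprD mulrA; apply: idealMl => //; exact: y0X_mem.
by apply: one_notin; rewrite -[1]mulr1; apply: (mono N 0 0)%N.
Qed.

Lemma grid_CM : is_grid S -> cohen_macaulay_quot I.
Proof.
move=> gS; have Igrid f := fat_ideal_grid c m f gS.
have IL : nzd I linf.
  by apply: (nzd_ext _ (@nzd_grid_linf k c (rows S) (cols S) m)) => g; apply: iff_sym.
have IM : nzd (adj I linf) minf.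
  apply: (nzd_ext _ (@nzd_grid_minf k c (rows S) (cols S) m)) => g.
  by split; apply: adj_mono => h /Igrid.
have d2 : depth_ge I 2.
  exists [:: linf; minf]; split=> //; split.
    by move=> f; rewrite !inE => /orP [] /eqP ->; [exact: irrelevant_linf|exact: irrelevant_minf].
  split=> [[|[|//]] _ /=|/(ideal_add_gen2 _ _ _ II)]; last exact: one_notin.
    by apply: nzd_ext IL => g; apply: iff_sym; exact: ideal_add_gen_nil.
  by apply: nzd_ext IM => g; apply: iff_sym; exact: ideal_add_gen1.
(* A prime over I contains the m-th powers of [Fx] and [Gy], hence a factor of each. *)
have nk3 : ~ krull_dim_ge I 3.
  apply: krull_dim_lt3 => P pP IP.
  have [a _ Pa] := prime_prod pP (prime_exp pP (IP _ FxX_fat_ideal)).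
  have [b _ Pb] := prime_prod pP (prime_exp pP (IP _ GyX_fat_ideal)).
  by exists a, b.
move=> n; case: (leqP n 2) => [n2|n3].
  by split=> _; [apply: depth_ge_leq d2|apply: krull_dim_ge_leq (krull_dim_ge2 S0 m0)].
split=> [/(krull_dim_ge_leq n3) //|/(depth_ge_leq n3) d3].
by case: (depth_ge3_false IL IM d3).
Qed.

(** Depth at least 2 only provides some regular sequence f1, f2; as powers of both lie in Q,
    [nzd_adj_of_regular] gives the regularity of [minf] modulo [linf]. *)
Lemma CM_regular : cohen_macaulay_quot I -> nzd (adj I linf) minf.
Proof.
move=> /(_ 2) [+ _] => /(_ (krull_dim_ge2 S0 m0)).
move=> [fs [sz [fi [fr _]]]].
case: fs sz fi fr => [|f1 [|f2 [|? ?]]] // _ fi fr.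
have r1 : nzd I f1.
  apply: nzd_ext (fr 0%N isT) => g; exact: ideal_add_gen_nil.
have r2 : nzd (adj I f1) f2.
  apply: nzd_ext (fr 1%N isT) => g; exact: ideal_add_gen1.
have [|n1 Q1] := @irrelevant_nilpotent f1; first by apply: fi; rewrite inE eqxx.
have [|n2 Q2] := @irrelevant_nilpotent f2; first by apply: fi; rewrite !inE eqxx orbT.
apply: (nzd_adj_of_regular (n := (n1 + n2)%N) II r1 r2); rewrite exprD.
  by rewrite mulrC; apply: idealMl.
exact: idealMl.
Qed.

End Scheme.

End GridCM.

(** * Bihomogeneous components and dehomogenization *)

Section Components.
Variable k : closedFieldType.
Notation R := {mpoly k[4]}.
Implicit Types f g u : R.

Definition xdeg (mo : 'X_{1..4}) := (mo i0 + mo i1)%N.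
Definition ydeg (mo : 'X_{1..4}) := (mo i2 + mo i3)%N.

Lemma xdeg0 : xdeg 0%MM = 0%N.
Proof. by rewrite /xdeg !mnm0E. Qed.
Lemma xdegD : {morph xdeg : m1 m2 / (m1 + m2)%MM >-> (m1 + m2)%N}.
Proof. by move=> m1 m2; rewrite /xdeg !mnmDE addnACA. Qed.
Lemma ydeg0 : ydeg 0%MM = 0%N.
Proof. by rewrite /ydeg !mnm0E. Qed.
Lemma ydegD : {morph ydeg : m1 m2 / (m1 + m2)%MM >-> (m1 + m2)%N}.
Proof. by move=> m1 m2; rewrite /ydeg !mnmDE addnACA. Qed.

HB.instance Definition _ := isMeasure.Build 4 xdeg xdeg0 xdegD.
HB.instance Definition _ := isMeasure.Build 4 ydeg ydeg0 ydegD.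

Definition bicomp d e : R -> R := pihomog xdeg d \o pihomog ydeg e.

HB.instance Definition _ d e := GRing.Linear.on (bicomp d e).

Lemma bicompX d e mo :
  bicomp d e 'X_[mo] = if (xdeg mo == d) && (ydeg mo == e) then 'X_[mo] else 0.
Proof.
rewrite /bicomp /= pihomogX andbC; case: ifP => _ /=; last by rewrite pihomog0.
by rewrite pihomogX.
Qed.

Lemma bihomogeneous_sum (I : Type) (s : seq I) (F : I -> R) a b :
  (forall i, bihomogeneous (F i) a b) -> bihomogeneous (\sum_(i <- s) F i) a b.
Proof.
move=> Fab; elim: s => [|i s IH]; first by rewrite big_nil => mo; rewrite msupp0.
by rewrite big_cons; apply: bihomogeneousD.
Qed.

Lemma bicomp_bihomogeneous d e f : bihomogeneous (bicomp d e f) d e.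
Proof.
rewrite (mpolyE f) linear_sum; apply: bihomogeneous_sum => mo.
rewrite linearZ /= -mul_mpolyC; apply: bihomogeneousCM.
rewrite bicompX; case: ifP => [/andP [/eqP dx /eqP dy] mo'|_ mo']; last by rewrite msupp0.
by rewrite msuppX inE => /eqP ->.
Qed.

Lemma bicomp_id d e f : bihomogeneous f d e -> bicomp d e f = f.
Proof.
move=> fde; rewrite {1}(mpolyE f) linear_sum [RHS]mpolyE; apply: eq_big_seq => mo /fde [dx dy].
by rewrite linearZ /= bicompX /xdeg /ydeg dx dy !eqxx.
Qed.

(** Multiplication by a form shifts bidegrees; the test guards against truncated subtraction and
    returns 0 when the bidegree of [u] does not fit below (d, e). *)
Lemma bicomp_mul u a b d e f : bihomogeneous u a b ->
  bicomp d e (u * f) =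
  u * (if (a <= d)%N && (b <= e)%N then bicomp (d - a) (e - b) f else 0).
Proof.
move=> uab; rewrite {1}(mpolyE u) [in RHS](mpolyE u) !mulr_suml linear_sum.
apply: eq_big_seq => mo /uab [dx dy]; rewrite -!scalerAl linearZ; congr (_ *: _).
elim/mpolyind: f => [|z mf f _ _ IH].
  by rewrite mulr0 !linear0 if_same mulr0.
rewrite mulrDr linearD IH /= -scalerAr linearZ /= -mpolyXD bicompX xdegD ydegD.
rewrite /xdeg /ydeg dx dy -/(xdeg mf) -/(ydeg mf).
have [/andP [ad be]|nle] := boolP ((a <= d)%N && (b <= e)%N); last first.
  rewrite mulr0 addr0; case: andP => [[/eqP E1 /eqP E2]|_]; last by rewrite scaler0.
  by move: nle; rewrite -E1 -E2 !leq_addr.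
rewrite linearD linearZ /= bicompX mulrDr; congr (_ + _).
rewrite -(eqn_add2l a (xdeg mf)) subnKC // -(eqn_add2l b (ydeg mf)) subnKC //.
by case: ifP => _; rewrite ?mulr0 ?scaler0 ?mulr0 // -scalerAr -mpolyXD.
Qed.

Lemma bihomogeneousX u a b n : bihomogeneous u a b -> bihomogeneous (u ^+ n) (n * a) (n * b).
Proof.
move=> uab; elim: n => [|n IH]; first by rewrite expr0; apply: (@bihomogeneousC k 1).
by rewrite exprS !mulSn; apply: bihomogeneousM.
Qed.

Lemma pw_bicomp c a b m d e f :
  pw (@zid k) (lx c a) (ly c b) m f -> pw (@zid k) (lx c a) (ly c b) m (bicomp d e f).
Proof.
elim: m d e f => [|m IH] d e f //= [g [z [pg E]]].
have {}E : f = lx c a * g + ly c b ^+ m.+1 * z.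
  by apply/eqP; rewrite -subr_eq0; apply/eqP.
rewrite E linearD /= (bicomp_mul _ _ _ (@bihomogeneous_lx k c a)).
rewrite (bicomp_mul _ _ _ (@bihomogeneousX _ _ _ m.+1 (@bihomogeneous_ly k c b))).
set g' := (X in lx c a * X); set z' := (X in _ ^+ m.+1 * X).
exists g', z'; split; last exact: (ideal_subrr _ (@zid_ideal k)).
by rewrite /g'; case: ifP => _; [apply: IH|case: (pw_ideal (lx c a) (ly c b) m (@zid_ideal k))].
Qed.

Lemma fat_ideal_bicomp c S m d e f :
  fat_ideal c S m f -> fat_ideal c S m (bicomp d e f).
Proof. by move=> fS ab abS; apply: pw_bicomp; apply: fS. Qed.

End Components.

(** * Dehomogenization and Taylor expansion along a row *)

Section Dehomogenize.
Variables (k : closedFieldType) (c : k).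
Notation R := {mpoly k[4]}.

Lemma subst_morph (A B : comNzRingType) (h : {rmorphism k -> A})
    (h' : {rmorphism k -> B}) (phi : {rmorphism A -> B}) p l q m f :
  (forall a, phi (h a) = h' a) ->
  phi (subst c h p l q m f) = subst c h' (phi p) (phi l) (phi q) (phi m) f.
Proof.
move=> hh; elim/(@mpoly4_ind k c): f => [e|f g Hf Hg|f g Hf Hg||||];
  by rewrite ?substE ?rmorphD ?rmorphM ?Hf ?Hg.
Qed.

Lemma subst_monomials (A : comNzRingType) (h : {rmorphism k -> A}) p l q m f :
  subst c h p l q m f = \sum_(mo <- msupp f) h f@_mo *
    (p ^+ mo i0 * (l + h c * p) ^+ mo i1 * (q ^+ mo i2 * (m + h c * q) ^+ mo i3)).
Proof.
apply: eq_bigr => mo _; congr (_ * _); rewrite /mmap1 !big_ord_recl !big_ord0 /=.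
rewrite mulr1 !mulrA; congr (_ ^+ mo _ * _ ^+ mo _ * _ ^+ mo _ * _ ^+ mo _);
  exact: val_inj.
Qed.

Definition sizes (e : nat) (p : {poly {poly k}}) := forall i, (size (p`_i)%R <= e.+1)%N.

Lemma sizes_sum (I : eqType) (s : seq I) e (F : I -> {poly {poly k}}) :
  (forall i, i \in s -> sizes e (F i)) -> sizes e (\sum_(i <- s) F i).
Proof.
move=> Fe i; rewrite coef_sum (leq_trans (size_sum _ _ _)) //.
by rewrite big_seq; elim/big_ind: _ => // [x y|j /Fe]; rewrite ?geq_max => // ->.
Qed.

Lemma sizesM e e' p q : sizes e p -> sizes e' q -> sizes (e + e') (p * q).
Proof.
move=> pe qe i; rewrite coefM (leq_trans (size_sum _ _ _)) //.
apply/bigmax_leqP => j _; rewrite (leq_trans (size_polyMleq _ _)) //.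
by have := pe j; have := qe (i - j)%N; lia.
Qed.

Lemma sizesD e p q : sizes e p -> sizes e q -> sizes e (p + q).
Proof.
by move=> pe qe i; rewrite coefD (leq_trans (size_polyD _ _)) // geq_max pe qe.
Qed.

Lemma sizesC e (p : {poly k}) : (size p <= e.+1)%N -> sizes e p%:P.
Proof. by move=> pe i; rewrite coefC; case: ifP; rewrite ?size_poly0. Qed.

Lemma sizesX : sizes 0 'X.
Proof. by move=> i; rewrite coefX; case: eqP; rewrite ?size_poly1 ?size_poly0. Qed.

Lemma sizesXn e p n : sizes e p -> sizes (n * e) (p ^+ n).
Proof.
move=> pe; elim: n => [|n IH]; first by rewrite expr0; apply: sizesC; rewrite size_poly1.
by rewrite exprS mulSn; apply: sizesM.
Qed.

Definition polyCC : k -> {poly {poly k}} := polyC \o polyC.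
HB.instance Definition _ := GRing.RMorphism.on polyCC.

(* Taylor expansion along the row x0 = a linf: the outer variable is x0 - a. *)
Definition rho (a : k) : R -> {poly {poly k}} :=
  subst c polyCC ('X + polyCC a) 1 'X%:P 1.

HB.instance Definition _ a := GRing.RMorphism.on (rho a).

(** Restriction to y0 = y minf, in the affine coordinate x0 / linf. *)
Definition uni (y : k) : R -> {poly k} := subst c (@polyC k) 'X 1 y%:P 1.

HB.instance Definition _ y := GRing.RMorphism.on (uni y).

Lemma rho_sizes a f d e : bihomogeneous f d e -> sizes e (rho a f).
Proof.
move=> fde; rewrite /rho subst_monomials; apply: sizes_sum => mo /fde [_ <-].
have C0 z : sizes 0 (polyCC z) by apply: sizesC; rewrite size_polyC; case: eqP.
have Xa : sizes 0 ('X + polyCC a) by apply: sizesD => //; apply: sizesX.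
have Y1 : sizes 1 'X%:P by apply: sizesC; rewrite size_polyX.
have one n : sizes n 1 by apply: sizesC; rewrite size_poly1.
have M0 e1 p q : sizes 0 p -> sizes e1 q -> sizes e1 (p * q) := @sizesM 0 e1 p q.
have X0 p n : sizes 0 p -> sizes 0 (p ^+ n).
  by move=> /(sizesXn n); rewrite muln0.
have X1 p n : sizes 1 p -> sizes n (p ^+ n).
  by move=> /(sizesXn n); rewrite muln1.
apply: (M0) => //; apply: (M0).
  by apply: (M0); apply: (X0) => //; apply: sizesD => //; apply: (M0).
apply: sizesM; apply: (X1) => //; apply: sizesD => //.
exact: (M0).
Qed.

Lemma uni_size y f d e : bihomogeneous f d e -> (size (uni y f) <= d.+1)%N.
Proof.
move=> fde; rewrite /uni subst_monomials (leq_trans (size_sum _ _ _)) //.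
rewrite big_seq; elim/big_ind: _ => // [u v|mo /fde [<- _]].
  by rewrite geq_max => -> ->.
have sX (p : {poly k}) n : (size p <= 2)%N -> (size (p ^+ n) <= n.+1)%N.
  move=> p2; rewrite (leq_trans (size_poly_exp_leq _ _)) // ltnS.
  by rewrite -[X in (_ <= X)%N]mul1n leq_mul2r; apply/orP; right; lia.
have s0 (p : {poly k}) n : (size p <= 1)%N -> (size (p ^+ n) <= 1)%N.
  by move=> /size1_polyC ->; rewrite -rmorphXn /= size_polyC; case: eqP.
have sM (p q : {poly k}) i j : (size p <= i.+1)%N -> (size q <= j.+1)%N -> (size (p * q)%R <= (i + j).+1)%N.
  by move=> pi qj; rewrite (leq_trans (size_polyMleq _ _)) //; lia.
have C1 (z : k) : (size z%:P <= 1)%N by rewrite size_polyC; case: eqP.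
have M0 (p q : {poly k}) i : (size p <= 1)%N -> (size q <= i.+1)%N -> (size (p * q)%R <= i.+1)%N.
  exact: (sM p q 0%N i).
apply: (M0); [exact: C1|]; rewrite mulrC; apply: (M0).
  apply: (M0); apply: s0 => //.
  by rewrite (leq_trans (size_polyD _ _)) // geq_max size_poly1 /=; apply: (M0).
apply: sM; apply: sX; first by rewrite size_polyX.
by rewrite (leq_trans (size_polyD _ _)) // geq_max size_poly1 /=; apply: (M0); rewrite ?size_polyX.
Qed.

(** Lets the order of vanishing at [a] be read off the Taylor coefficients before y is
    specialized. *)
Lemma uni_rho y a f :
  uni y f = map_poly (horner_eval y) (rho a f) \Po ('X - a%:P).
Proof.
pose phi : {rmorphism {poly {poly k}} -> {poly k}} := GRing.RMorphism.clone _ _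
  (comp_poly ('X - a%:P) \o map_poly (horner_eval y)) _.
have -> : map_poly (horner_eval y) (rho a f) \Po ('X - a%:P) = phi (rho a f) by [].
rewrite /rho (subst_morph (h' := @polyC k)) => [|z].
  rewrite /phi /= rmorphD /= map_polyX /polyCC /= !map_polyC /= /horner_eval !hornerC.
  by rewrite hornerX comp_polyD comp_polyX !comp_polyC subrK polyC1.
by rewrite /phi /= /polyCC /= map_polyC /= /horner_eval hornerC comp_polyC.
Qed.

(** Under [rho], [lx a] becomes the outer variable X and [ly b] the constant y - b, and the i-th
    coefficient of an element of (X, y - b)^m is divisible by (y - b)^(m - i). *)
Lemma rho_dvd a b m f i : pw (@zid k) (lx c a) (ly c b) m f ->
  (('X - b%:P) ^+ (m - i) %| (rho a f)`_i)%R.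
Proof.
elim: m f i => [|m IH] f i; first by rewrite sub0n expr0 dvd1p.
move=> [g [z [pg E]]].
have {}E : f = lx c a * g + ly c b ^+ m.+1 * z.
  by apply/eqP; rewrite -subr_eq0; apply/eqP.
rewrite E rmorphD !rmorphM rmorphXn /= /rho subst_lx subst_ly -/(rho a).
have -> : 'X + polyCC a - polyCC a * 1 = 'X :> {poly {poly k}} by rewrite mulr1 addrK.
have -> : 'X%:P - polyCC b * 1 = ('X - b%:P)%:P :> {poly {poly k}}.
  by rewrite mulr1 rmorphB.
rewrite -rmorphXn /= coefD coefXM coefCM dvdp_add //.
  by case: i => [|i]; rewrite ?dvdp0 //= subSS; apply: IH.
by rewrite dvdp_mulr // dvdp_exp2l // leq_subr.
Qed.

End Dehomogenize.

Section UnivariateProducts.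
Variable F : fieldType.

Lemma prod_XsubC_dvd (s : seq F) (n : F -> nat) (p : {poly F}) : uniq s ->
  (forall b, b \in s -> ('X - b%:P) ^+ n b %| p) ->
  \prod_(b <- s) ('X - b%:P) ^+ n b %| p.
Proof.
elim: s => [|b s IH] /=; first by rewrite big_nil dvd1p.
move=> /andP [bs us] sp; rewrite big_cons Gauss_dvdp.
  rewrite sp ?mem_head //= IH // => b' b's; apply: sp.
  by rewrite inE b's orbT.
apply: coprimep_expl; rewrite coprimep_sym coprimep_XsubC /root horner_prod prodf_seq_neq0.
apply/allP => b' b's /=; rewrite horner_exp hornerXsubC expf_neq0 // subr_eq0.
by apply: contraNneq bs => ->.
Qed.

Lemma size_prod_XsubC_exp (s : seq F) (n : F -> nat) :
  size (\prod_(b <- s) ('X - b%:P) ^+ n b) = (\sum_(b <- s) n b).+1.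
Proof.
elim: s => [|b s IH]; first by rewrite !big_nil size_poly1.
have nz (t : seq F) : \prod_(b <- t) ('X - b%:P) ^+ n b != 0.
  rewrite prodf_seq_neq0; apply/allP => b' _ /=.
  by rewrite expf_neq0 // polyXsubC_eq0.
rewrite !big_cons size_mul ?expf_neq0 ?polyXsubC_eq0 // IH size_exp_XsubC.
by rewrite addnS.
Qed.

End UnivariateProducts.

(** * From depth 2 to grids *)

Section CMGrid.
Variables (k : closedFieldType) (c : k) (S : seq (k * k)) (m : nat).
Hypothesis m2 : (2 <= m)%N.
Notation R := {mpoly k[4]}.
Notation zid := (@zid k).
Notation lx := (@lx k c).
Notation ly := (@ly k c).
Notation linf := (@linf k c).
Notation minf := (@minf k c).
Notation x0 := (@x0 k).
Notation I := (fat_ideal c S m).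
Notation A := (rows S).
Notation B := (cols S).

Let II : ideal I := fat_ideal_ideal c S m.
Let uA : uniq A := undup_uniq _.
Let uB : uniq B := undup_uniq _.

Definition colsat a := [seq b <- B | (a, b) \in S].
Definition rowsat b := [seq a <- A | (a, b) \in S].
Definition is_full b := all (fun a => (a, b) \in S) A.
Definition full := [seq b <- B | is_full b].

(* [strip a] is the number of factors lx a forced on an element of I whose
   y-degree is the number of full columns. *)
Definition strip a := if (size full < size (colsat a))%N then m else m.-1.
Definition nstrip := (\sum_(a <- A) strip a)%N.

Lemma full_colsat a : a \in A -> {subset full <= colsat a}.
Proof.
by move=> aA b; rewrite !mem_filter => /andP [/allP /(_ a aA) -> ->].
Qed.

Lemma full_colsat_lt a b : (a, b) \in S -> ~~ is_full b ->
  (size full < size (colsat a))%N.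
Proof.
move=> abS nfb.
have aA : a \in A by apply/rowsP; exists b.
have bB : b \in B by apply/colsP; exists a.
apply: (@uniq_leq_size _ (b :: full)).
  by rewrite /= mem_filter (negPf nfb) filter_uniq.
move=> b'; rewrite inE => /orP [/eqP ->|]; last exact: full_colsat.
by rewrite mem_filter abS.
Qed.

Lemma strip_ge a : (m.-1 <= strip a)%N.
Proof. by rewrite /strip; case: ifP; rewrite ?leq_pred. Qed.

(** Every row contains the full columns; if no row has more, all rows are equal to the set of full
    columns. *)
Lemma grid_or_gap : is_grid S \/ exists2 a, a \in A & (size full < size (colsat a))%N.
Proof.
have [|/allPn [a aA]] := boolP (all (fun a => size (colsat a) <= size full)%N A);
  last by rewrite -ltnNge; right; exists a.
move=> /allP le; left => a b aA /colsP [a' a'bS].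
have a'A : a' \in A by apply/rowsP; exists b.
have [_ E] := uniq_min_size (filter_uniq _ uB) (full_colsat a'A) (le _ a'A).
have : b \in colsat a' by rewrite mem_filter a'bS; apply/colsP; exists a'.
by rewrite -E mem_filter => /andP [/allP /(_ a aA)].
Qed.

Lemma sum_strip_ge (s : seq k) : (m.-1 * size s <= \sum_(a <- s) strip a)%N.
Proof.
elim: s => [|a s IH]; first by rewrite muln0.
by rewrite big_cons /= mulnS leq_add // strip_ge.
Qed.

Lemma nstrip_gt_rows a : a \in A -> (size full < size (colsat a))%N ->
  (size A * m.-1 < nstrip)%N.
Proof.
move=> aA gap; rewrite /nstrip (big_rem a) //= {1}/strip gap.
have := sum_strip_ge (rem a A); rewrite size_rem //.
have : (0 < size A)%N by case: (A) aA.
by case: (size A) => // n _ /=; rewrite mulSn mulnC; lia.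
Qed.

(** A row meeting the non-full column [b] has more columns than the full ones, so it counts m. *)
Lemma nstrip_gt_col b : b \in B -> ~~ is_full b -> (size (rowsat b) * m < nstrip)%N.
Proof.
move=> bB nfb; rewrite /nstrip (bigID (fun a => (a, b) \in S)) /=.
have -> : (\sum_(a <- A | (a, b) \in S) strip a = size (rowsat b) * m)%N.
  rewrite (eq_bigr (fun=> m)); last by move=> a abS; rewrite /strip (full_colsat_lt abS).
  by rewrite -big_filter big_const_seq count_predT iter_addn_0 mulnC.
(* A row missing [b] counts at least m - 1, which is positive because m >= 2. *)
have /allPn [a aA naS] := nfb.
rewrite -[X in (X < _)%N]addn0 ltn_add2l (big_rem a) //= naS.
by rewrite (leq_trans _ (leq_addr _ _)) // (leq_trans _ (strip_ge a)) //; lia.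
Qed.

(** * Descent from all columns to the full columns *)

Section Descent.
Hypothesis reg : nzd (adj I linf) minf.

Let JI : ideal (adj I linf) := adj_ideal linf II.

(** An ideal of leading coefficients: on [linf = 0], x0^d h is the trace of an element of I. *)
Definition lead d (h : R) := adj I linf (x0 ^+ d * h).

Lemma lead_ideal d : ideal (lead d).
Proof.
split; [by rewrite /lead mulr0; case: JI|split=> [f g Jf Jg|r f Jf]].
  by rewrite /lead mulrDr; apply: idealD.
by rewrite /lead mulrCA; apply: idealMl.
Qed.

Lemma lead_nzd d : nzd (lead d) minf.
Proof. by move=> h; rewrite /lead mulrCA => /reg. Qed.

Lemma lead_of_fat s n d h : (size s * n <= d)%N -> I (Fx c s ^+ n * h) -> lead d h.
Proof.
move=> le Ih; have [z Ez] := FxX_mod_linf c s n.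
have Jh : adj I linf (x0 ^+ (size s * n) * h).
  exists (- z * h); rewrite /zid in Ez.
  rewrite (_ : _ - _ = Fx c s ^+ n * h - h * (Fx c s ^+ n - x0 ^+ (size s * n) - z * linf)); last by ring.
  by rewrite Ez mulr0 subr0.
by rewrite /lead -(subnK le) exprD -mulrA; apply: idealMl.
Qed.

Lemma lead_cols d : (size A * m.-1 <= d)%N -> lead d (Gy c B).
Proof.
move=> le; apply: (lead_of_fat le) => [[a b]] abS /=.
have aA : a \in A by apply/rowsP; exists b.
have bB : b \in B by apply/colsP; exists a.
rewrite /Fx /Gy (big_rem a aA) (big_rem b bB) /= exprMn.
have := pw_mulX (lx a) (ly b) m.-1 1
  ((\prod_(y <- rem a A) lx y) ^+ m.-1 * \prod_(y <- rem b B) ly y) (@zid_ideal k).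
rewrite addn1 prednK ?(ltnW m2) // expr1.
by congr (pw _ _ _ _ _); ring.
Qed.

Lemma lead_rem d b : (size (rowsat b) * m <= d)%N -> lead d (Gy c (rem b B) ^+ m).
Proof.
(* A point of column [b] lies in a row of [rowsat b], which supplies m factors; any other point has
   its column among the remaining ones. *)
move=> le; apply: (lead_of_fat le) => [[a b']] abS /=.
have aA : a \in A by apply/rowsP; exists b'.
have [bb|bb] := eqVneq b' b.
  have ab : a \in rowsat b by rewrite mem_filter -bb abS.
  rewrite /Fx (big_rem a ab) /= exprMn -mulrA.
  have := pw_mulX (lx a) (ly b') m 0 ((\prod_(y <- rem a (rowsat b)) lx y) ^+ m *
     Gy c (rem b B) ^+ m) (@zid_ideal k).
  by rewrite addn0 expr0 mulr1.
have bB : b' \in rem b B.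
  by rewrite mem_rem_uniq // inE bb; apply/colsP; exists a.
rewrite /Gy (big_rem b' bB) /= exprMn mulrCA.
have := pw_mulX (lx a) (ly b') 0 m (Fx c (rowsat b) ^+ m *
   (\prod_(y <- rem b' (rem b B)) ly y) ^+ m) (@zid_ideal k).
by rewrite add0n expr0 mul1r.
Qed.

(** Modulo [ly b], each [ly b'] is the nonzero multiple (b - b') [minf]. *)
Lemma Gy_mod_ly b t n : b \notin t ->
  exists2 e : k, e != 0 & adj zid (ly b) (Gy c t ^+ n - e%:MP * minf ^+ (size t * n)).
Proof.
move=> bt; have JJ := adj_ideal (ly b) (@zid_ideal k).
have [e e0 Je] : exists2 e : k, e != 0 & adj zid (ly b) (Gy c t - e%:MP * minf ^+ size t).
  rewrite /Gy; elim: t bt => [|b' t IH].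
    by exists 1; rewrite ?oner_neq0 // big_nil mpolyC1 expr0 mulr1 subrr; case: JJ.
  rewrite inE negb_or => /andP [bb' /IH [e e0 Je]].
  exists ((b - b') * e); first by rewrite mulf_neq0 // subr_eq0.
  have Jb : adj zid (ly b) (ly b' - (b - b')%:MP * minf).
    by exists 1; rewrite /zid /ly mpolyCB; ring.
  rewrite big_cons /= exprS mpolyCM.
  apply: (ideal2 (r := \prod_(y <- t) ly y) (s := (b - b')%:MP * minf) JJ Jb Je); ring.
exists (e ^+ n); first by rewrite expf_neq0.
elim: n => [|n IH]; first by rewrite muln0 !expr0 mpolyC1 mulr1 subrr; case: JJ.
rewrite mulnS exprD !exprS mpolyCM.
apply: (ideal2 (r := Gy c t ^+ n) (s := e%:MP * minf ^+ size t) JJ Je IH); ring.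
Qed.

(** Modulo [ly b] the element of [lead_rem] is a nonzero constant times a power of [minf].
    Multiplied by [h], it puts that power times [h] into [lead d], where [minf] is regular. *)
Lemma lead_cancel d b h : b \in B -> ~~ is_full b -> (nstrip <= d.+1)%N ->
  lead d (ly b * h) -> lead d h.
Proof.
move=> bB nfb le Kb.
have [|e e0 [z Ez]] := @Gy_mod_ly b (rem b B) m; first by rewrite mem_rem_uniq // inE eqxx.
have Kr : lead d (Gy c (rem b B) ^+ m).
  by apply: lead_rem; rewrite -ltnS; apply: leq_trans le; apply: nstrip_gt_col.
have Ke : lead d (minf ^+ (size (rem b B) * m) * h).
  have eV : e^-1%:MP * e%:MP = 1 :> R by rewrite -mpolyCM mulVf // mpolyC1.
  apply: (ideal2 (r := e^-1%:MP * h) (s := - (e^-1%:MP * z)) (lead_ideal d) Kr Kb).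
  rewrite -[LHS]mul1r -eV; apply/eqP; rewrite -subr_eq0; apply/eqP.
  by rewrite -[RHS](mulr0 (- e^-1%:MP * h)) -Ez; ring.
exact: (nzdX (lead_nzd (d := d)) Ke).
Qed.

(** Start from the product over all columns and cancel the non-full ones one by one. *)
Lemma lead_full d : (size A * m.-1 <= d)%N -> (nstrip <= d.+1)%N -> lead d (Gy c full).
Proof.
move=> leA le; have := lead_cols leA.
have -> : Gy c B = Gy c [seq b <- B | ~~ is_full b] * Gy c full.
  by rewrite /Gy /full !big_filter mulrC [LHS](bigID is_full).
have : {subset [seq b <- B | ~~ is_full b] <= [pred b | (b \in B) && ~~ is_full b]}.
  by move=> b; rewrite mem_filter andbC.
elim: [seq b <- B | _] => [|b t IH] sub; first by rewrite /Gy big_nil mul1r.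
rewrite {1}/Gy big_cons -mulrA -/(Gy c t) => Kb; apply: IH.
  by move=> b' b't; apply: sub; rewrite inE b't orbT.
have /andP [bB nfb] := sub b (mem_head _ _).
exact: lead_cancel Kb.
Qed.

(** The coefficient has degree at most [size full] in y but is divisible by (y - b)^(m - i) for
    every [b] in [colsat a], too many factors if it is nonzero. *)
Lemma coef_rho_eq0 a g d i : a \in A -> I g -> bihomogeneous g d (size full) ->
  (i < strip a)%N -> (rho c a g)`_i = 0.
Proof.
move=> aA Ig bg lt; apply/eqP/negPn/negP => nz.
have dv : \prod_(b <- colsat a) ('X - b%:P) ^+ (m - i) %| (rho c a g)`_i.
  apply: (@prod_XsubC_dvd _ _ (fun=> m - i)%N); first by rewrite filter_uniq.
  by move=> b; rewrite mem_filter => /andP [abS _]; apply: rho_dvd; apply: (Ig _ abS).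
have := dvdp_leq nz dv; rewrite (size_prod_XsubC_exp _ (fun=> m - i)%N).
rewrite big_const_seq count_predT iter_addn_0 => le1.
have le2 := @rho_sizes k c a g d (size full) bg i.
have : ((m - i) * size (colsat a) <= size full)%N by rewrite -ltnS (leq_trans le1).
have lef : (size full <= size (colsat a))%N.
  by apply: uniq_leq_size (full_colsat aA); rewrite filter_uniq.
have [b abS] := rowsP _ _ aA.
have : (0 < size (colsat a))%N.
  have : b \in colsat a by rewrite mem_filter abS; apply/colsP; exists a.
  by case: (colsat a).
(* If the row has more columns than the full ones, one factor per column is enough; otherwise the
   two numbers agree and are positive, and two factors per column are needed, whence m - 1. *)
move: lt; rewrite /strip; case: ifP => gap lt pos.
  have : (0 < m - i)%N by lia.
  by move: gap; nia.
have : (1 < m - i)%N by lia.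
by nia.
Qed.

Lemma strip_dvd a g d y : a \in A -> I g -> bihomogeneous g d (size full) ->
  ('X - a%:P) ^+ strip a %| uni c y g.
Proof.
move=> aA Ig bg; rewrite (uni_rho c y a g).
set q := map_poly _ _.
have E : q = drop_poly (strip a) q * 'X^(strip a).
  rewrite -{1}(poly_take_drop (strip a) q) (_ : take_poly _ q = 0) ?add0r //.
  apply/polyP => i; rewrite coef_take_poly coef0; case: ifP => // lt.
  by rewrite /q coef_map (coef_rho_eq0 aA Ig bg lt) /= /horner_eval horner0.
by rewrite E comp_polyM comp_Xn_poly dvdp_mull.
Qed.

Lemma no_gap a : a \in A -> (size full < size (colsat a))%N -> False.
Proof.
move=> aA gap; have gtA := nstrip_gt_rows aA gap.
have n0 : (0 < nstrip)%N by apply: leq_ltn_trans gtA.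
(* One less than the number of forced factors: large enough for [lead_full], too small for the
   divisibility at the end. *)
pose d := nstrip.-1; have dS : d.+1 = nstrip by rewrite prednK.
have leA : (size A * m.-1 <= d)%N by rewrite -ltnS dS.
have [z Iz] := lead_full leA (eq_leq (esym dS)).
have bD : bihomogeneous (x0 ^+ d * Gy c full) d (size full).
  have := bihomogeneousM (@bihomogeneousX k x0 1 0 d (@bihomogeneous_x0 k)) (@bihomogeneous_Gy k c full).
  by rewrite muln1 muln0 addn0.
(* The component of the cofactor [z] that makes [g] bihomogeneous of bidegree (d, [size full]); it
   is 0 when d = 0. *)
pose e := if (1 <= d)%N && (0 <= size full)%N then bicomp (d - 1)%N (size full - 0)%N z else 0.
pose g := x0 ^+ d * Gy c full - linf * e.
have Ig : I g.
  have := fat_ideal_bicomp d (size full) Iz.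
  by rewrite linearB /= (bicomp_id bD) (mulrC z) (bicomp_mul _ _ _ (@bihomogeneous_linf k c)).
have bg : bihomogeneous g d (size full).
  have := @bicomp_bihomogeneous k d (size full) (x0 ^+ d * Gy c full - z * linf).
  by rewrite linearB /= (bicomp_id bD) (mulrC z) (bicomp_mul _ _ _ (@bihomogeneous_linf k c)).
(* Since [y] avoids the full columns, their product does not vanish at [y] and the coefficient of
   X^d survives. *)
have [y yfull] := notin_closedField full.
have gd : (uni c y g)`_d != 0.
  have -> : uni c y g = 'X^d * (\prod_(b <- full) (y - b))%:P - uni c y e.
    rewrite rmorphB !rmorphM rmorphXn /= /uni substx0 subst_linf mul1r; congr (_ * _ - _).
    rewrite /Gy !rmorph_prod; apply: eq_bigr => b _.
    by rewrite /= subst_ly /= mulr1 polyCB.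
  rewrite coefB coefMC coefXn eqxx mul1r (_ : (uni c y e)`_d = 0) ?subr0.
    rewrite prodf_seq_neq0; apply/allP => b bf /=; rewrite subr_eq0.
    by apply: contraNneq yfull => ->.
  (* As [e] has x-degree d - 1, it does not contribute to X^d. *)
  rewrite /e; case: ifP => [/andP [d1 _]|_]; last by rewrite rmorph0 coef0.
  apply: nth_default; have := uni_size c y (@bicomp_bihomogeneous k (d - 1)%N (size full - 0)%N z).
  by move=> le; apply: leq_trans le _; lia.
have g0 : uni c y g != 0 by apply: contraNneq gd => ->; rewrite coef0.
have dv : \prod_(a <- A) ('X - a%:P) ^+ strip a %| uni c y g.
  by apply: prod_XsubC_dvd => // b bA; apply: strip_dvd bg.
have := dvdp_leq g0 dv; rewrite size_prod_XsubC_exp -/nstrip -dS.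
by rewrite leqNgt ltnS (uni_size c y bg).
Qed.

End Descent.

Lemma grid_of_regular : nzd (adj I linf) minf -> is_grid S.
Proof. by move=> reg; case: grid_or_gap => // [[a aA /(no_gap reg aA)]]. Qed.

End CMGrid.

(** * Invariance under equality of ideals, and the equivalence *)

Lemma cohen_macaulay_quot_ext (k : closedFieldType) (I J : {mpoly k[4]} -> Prop) :
  (forall f, I f <-> J f) -> cohen_macaulay_quot I -> cohen_macaulay_quot J.
Proof.
move=> IJ.
have K (I1 J1 : {mpoly k[4]} -> Prop) n : (forall f, I1 f <-> J1 f) ->
    krull_dim_ge I1 n -> krull_dim_ge J1 n.
  by move=> E [P [Pp [IP Pc]]]; exists P; do 2!split=> //; move=> f /E /IP.
have G (I1 J1 : {mpoly k[4]} -> Prop) gs f : (forall f, I1 f <-> J1 f) ->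
    ideal_add_gen I1 gs f -> ideal_add_gen J1 gs f.
  by move=> E [g [d [Ig H]]]; exists g, d; split=> //; apply/E.
have D (I1 J1 : {mpoly k[4]} -> Prop) n : (forall f, I1 f <-> J1 f) ->
    depth_ge I1 n -> depth_ge J1 n.
  move=> E [fs [sz [fi [fr f1]]]]; exists fs; split=> //; split=> //.
  have E' f : J1 f <-> I1 f by apply: iff_sym.
  split=> [i ilt|/(G _ _ _ _ E')//].
  by apply: nzd_ext (fr i ilt) => f; split; apply: G.
have JI f : J f <-> I f by apply: iff_sym.
move=> CM n; split=> [/(K _ _ _ JI)|/(D _ _ _ JI)] /CM; first exact: D.
exact: K.
Qed.

Lemma complete_intersection_ext (k : closedFieldType) (I J : {mpoly k[4]} -> Prop) :
  (forall f, I f <-> J f) -> complete_intersection I -> complete_intersection J.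
Proof.
move=> IJ [a [b [F [G [Fa [Gb FG]]]]]]; exists a, b, F, G; do 2!split=> //.
by move=> f; apply: iff_trans (FG f); apply: iff_sym.
Qed.

Theorem theorem5p4 (k : closedFieldType) (m : nat) (Z : seq (pt k * nat)) :
  (2 <= m)%N ->
  fat_point_scheme Z ->
  (forall p, p \in Z -> p.2 = m) ->
  (ACM Z <-> complete_intersection (supp_ideal Z)).
Proof.
move=> m2 [Z0 [Zv _]] Zm.
(* A single chart contains all points, so the problem reduces to the finite set S and the exponent
   m. *)
have [c Zc] := exists_chart Zv.
pose S := [seq chart c p.1 | p <- Z].
have S0 : S != [::] by rewrite /S; case: (Z) Z0.
have m0 : (0 < m)%N := ltnW m2.
have EZ f : fat_scheme_ideal Z f <-> fat_ideal c S m f.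
  exact: fat_scheme_ideal_chart.
have ES f : supp_ideal Z f <-> fat_ideal c S 1 f by exact: supp_ideal_chart.
split=> [/(cohen_macaulay_quot_ext EZ) CM|].
  apply: (@complete_intersection_ext _ (fat_ideal c S 1)) => [f|].
    exact: iff_sym.
  by apply: CI_of_grid; apply: grid_of_regular m2 _; apply: CM_regular.
move=> /(complete_intersection_ext ES) /grid_of_CI gS.
apply: (@cohen_macaulay_quot_ext _ (fat_ideal c S m)) => [f|]; first exact: iff_sym.
exact: grid_CM.
Qed.
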